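(* For every finite set $A\subset\mathbb{R}$ with $0\notin A$ and $|A|>1$, one has $$\max(|A+A|,\,|A\cdot A|)\gtrsim |A|^{\frac43+\frac1{1509}}.$$
   Context: $A+A=\{a+b: a,b\in A\}$ and $A\cdot A=\{ab: a,b\in A\}$. $U\gtrsim V$ means $V\le C_0(\log|A|)^{C_0}U$ for some absolute constant $C_0>0$ (independent of $A$). *)

(* Defs.v *)
From mathcomp Require Import all_boot all_order all_algebra.
From mathcomp Require Import finmap.
From mathcomp Require Import reals exp.

Set Implicit Arguments.
Unset Strict Implicit.
Unset Printing Implicit Defensive.

Import Order.TTheory GRing.Theory Num.Theory.

Local Open Scope fset_scope.
Local Open Scope ring_scope.

Definition sumset (R : realType) (A B : {fset R}) : {fset R} :=
  [fset a + b | a in A, b in B].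

Definition prodset (R : realType) (A B : {fset R}) : {fset R} :=
  [fset a * b | a in A, b in B].

(* The base matters because the same constant is used below as factor and as
   exponent: in base 2 the logarithm is at least 1 on [2, +oo[, so the bound
   V <= C0 (log n)^C0 U only gets weaker as C0 grows. With the natural
   logarithm, ln 2 < 1 and C0 (ln 2)^C0 tends to 0. *)
Definition log2 (R : realType) (x : R) : R := ln x / ln 2.

(* V <= C0 (log n)^C0 U; the constant C0 is a parameter so that it can be
   quantified before the set of size n on which U and V depend. *)
Definition gtrsim_with (R : realType) (C0 : R) (n : nat) (U V : R) : Prop :=
  V <= C0 * (log2 n%:R) `^ C0 * U.

(* Main.v *)
(* Let N = |A| and A_l = A cap l^-1 A; after passing to half of A and changing
   signs, A is positive. Fix a dyadic class of slopes l, with |A_l| ~ tau,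
   carrying most of the multiplicative energy E of A. Solymosi bounds E by
   |A + A|^2 through vector sums of points of A x A on consecutive lines through
   the origin. Following Konyagin and Shkredov, sums over windows of M lines gain
   a factor M unless many of them coincide; eliminating one variable from such
   coincidences yields many x in A_l', y in A_l'' with al x + be y in A_l, and
   then Szemeredi--Trotter makes A A_l nearly as large as AA. So, for half of the
   slopes at least, |A A_l| is at least some large T, and then l has at least T
   representations as a quotient of elements of AA, since A A_l lies in
   AA cap l^-1 AA. A dilate D of a large part of A consists of such slopes, so
   Szemeredi--Trotter controls the third moments of the representation functions
   of D - D and D - (D + D), and an argument of Schoen and Shkredov turns this
   into a lower bound for |D + D| <= |A + A|. Either N^3 <= |A + A| |AA| or
   N^722 <= |A + A|^322 |AA|^219, up to constants and powers of log N; and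
   722/541 > 4/3 + 1/1509.

   Szemeredi--Trotter is only needed for Cartesian products of points and lines
   of positive slope. There it is elementary: in an r x r subdivision of the
   grid such a line meets fewer than 2r cells, and one counts pairs of points
   in a common cell. *)
Require Import Defs.
From mathcomp Require Import all_boot all_order all_algebra.
From mathcomp Require Import finmap.
From mathcomp Require Import reals sequences exp.
From mathcomp Require Import zify ring lra.

Set Implicit Arguments.
Unset Strict Implicit.
Unset Printing Implicit Defensive.

Import Order.TTheory GRing.Theory Num.Theory.

Local Open Scope fset_scope.
Local Open Scope ring_scope.
Local Open Scope nat_scope.

(** * Counting coincidences *)

Lemma leq_sum_seq (I : eqType) (s : seq I) (F G : I -> nat) :
  {in s, forall i, F i <= G i} -> \sum_(i <- s) F i <= \sum_(i <- s) G i.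
Proof. by move=> h; rewrite big_seq [leqRHS]big_seq; apply: leq_sum. Qed.

Lemma sum_const_seq (I : Type) (s : seq I) (c : nat) :
  \sum_(i <- s) c = size s * c.
Proof. by rewrite big_const_seq count_predT iter_addn_0 mulnC. Qed.

Lemma sum_mem_uniq (I : eqType) (s : seq I) (x : I) :
  uniq s -> \sum_(i <- s) (x == i) = (x \in s).
Proof.
move=> us; rewrite -(count_uniq_mem x us) -sum1_count [RHS]big_mkcond /=.
by apply: eq_bigr => i _; rewrite eq_sym; case: eqP.
Qed.

Lemma sum_eq_le1 (I : eqType) (s : seq I) (P : pred I) :
  uniq s -> {in s &, forall x y, P x -> P y -> x = y} ->
  \sum_(i <- s) P i <= 1.
Proof.
move=> us h; have -> : \sum_(i <- s) P i = size (filter P s).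
  by rewrite size_filter -sum1_count [RHS]big_mkcond.
have : uniq (filter P s) by rewrite filter_uniq.
case E : (filter P s) => [|x [|y t]] //.
have hx : x \in filter P s by rewrite E mem_head.
have hy : y \in filter P s by rewrite E !inE eqxx orbT.
move: hx hy; rewrite !mem_filter => /andP[Px xs] /andP[Py ys].
by rewrite (h x y xs ys Px Py) /= inE eqxx.
Qed.

Lemma sum_le_size_subset (I : eqType) (s t : seq I) (P : pred I) :
  uniq s -> {in s, forall x, P x -> x \in t} -> \sum_(i <- s) P i <= size t.
Proof.
move=> us h; have -> : \sum_(i <- s) P i = size (filter P s).
  by rewrite size_filter -sum1_count [RHS]big_mkcond.
apply: uniq_leq_size; first exact: filter_uniq.
by move=> x; rewrite mem_filter => /andP[Px xs]; apply: h.
Qed.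

Lemma sum_fiber (I V : eqType) (s : seq I) (Z : seq V) (f : I -> V)
    (w : I -> nat) (F : V -> nat) :
  uniq Z -> {in s, forall i, f i \in Z} ->
  \sum_(i <- s) w i * F (f i) =
  \sum_(z <- Z) (\sum_(i <- s) w i * (f i == z)) * F z.
Proof.
move=> uZ h.
under [RHS]eq_bigr do rewrite big_distrl /=.
rewrite exchange_big /=; apply: eq_big_seq => i is_.
have -> : \sum_(z <- Z) w i * (f i == z) * F z =
          \sum_(z <- Z) (f i == z) * (w i * F (f i)).
  by apply: eq_bigr => z _; case: eqP => [->|_]; rewrite ?muln1 ?muln0 ?mul1n.
by rewrite -big_distrl /= sum_mem_uniq // h // mul1n.
Qed.

Lemma sum_cauchy (I : Type) (s : seq I) (f g : I -> nat) :
  (\sum_(i <- s) f i * g i) ^ 2 <=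
  (\sum_(i <- s) f i ^ 2) * (\sum_(i <- s) g i ^ 2).
Proof.
(* After doubling and symmetrising the double sum, each pair i, j is an instance of 2xy <= x^2 + y^2
   with x = f i * g j and y = f j * g i. *)
rewrite -mulnn !big_distrlr /= -(leq_pmul2l (isT : 0 < 2)).
rewrite [leqRHS]mul2n -addnn.
rewrite [X in _ <= _ + X]exchange_big /= -big_split /= big_distrr /=.
apply: leq_sum => i _; rewrite -big_split /= big_distrr /=.
apply: leq_sum => j _.
by rewrite (mulnACA (f i)) (mulnC (g i)) -(mulnACA (f i)) -!expnMn nat_Cauchy.
Qed.

Lemma sum_cauchy1 (I : Type) (s : seq I) (f : I -> nat) :
  (\sum_(i <- s) f i) ^ 2 <= size s * \sum_(i <- s) f i ^ 2.
Proof.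
have := sum_cauchy s (fun=> 1) f.
rewrite sum_const_seq muln1; congr (_ ^ 2 <= _).
by apply: eq_bigr => i _; rewrite mul1n.
Qed.

(** Cauchy--Schwarz for f^(1/2) and f^(3/2). It is argued on pairs i, j, where factoring out f i * f
    j avoids the roots. *)
Lemma sum_square_cauchy (I : Type) (s : seq I) (f : I -> nat) :
  (\sum_(i <- s) f i ^ 2) ^ 2 <=
  (\sum_(i <- s) f i) * \sum_(i <- s) f i ^ 3.
Proof.
rewrite -mulnn !big_distrlr /= -(leq_pmul2l (isT : 0 < 2)).
rewrite [leqRHS]mul2n -addnn.
rewrite [X in _ <= _ + X]exchange_big /= -big_split /= big_distrr /=.
apply: leq_sum => i _; rewrite -big_split /= big_distrr /=.
apply: leq_sum => j _.
have -> : f i * f j ^ 3 + f j * f i ^ 3 = (f i * f j) * (f j ^ 2 + f i ^ 2) by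
  ring.
have -> : 2 * (f i ^ 2 * f j ^ 2) = (f i * f j) * (2 * (f j * f i)) by ring.
by rewrite leq_mul2l nat_Cauchy orbT.
Qed.

(** With S1, S2, S3 the sums of the powers of [f], Cauchy--Schwarz twice gives S1^4 <= (size s)^2
    S2^2 <= (size s)^2 S1 S3, and a factor S1 cancels. *)
Lemma sum_cube (I : Type) (s : seq I) (f : I -> nat) :
  (\sum_(i <- s) f i) ^ 3 <= size s ^ 2 * \sum_(i <- s) f i ^ 3.
Proof.
set S1 := \sum_(i <- s) f i.
case: (posnP S1) => [->|S1_gt0]; first by rewrite exp0n.
rewrite -(leq_pmul2l S1_gt0) -expnS (mulnCA S1).
apply: leq_trans (_ : (size s * \sum_(i <- s) f i ^ 2) ^ 2 <= _).
  by rewrite (expnM S1 2 2) leq_sqr sum_cauchy1.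
by rewrite expnMn leq_mul2l sum_square_cauchy orbT.
Qed.

(** Cauchy--Schwarz over the fibres of [f]. Values at points of weight zero may lie outside [Z], so
    a weight can encode a membership condition. *)
Lemma collision (I V : eqType) (s : seq I) (Z : seq V) (f : I -> V)
    (w : I -> nat) :
  uniq Z -> {in s, forall i, 0 < w i -> f i \in Z} ->
  (\sum_(i <- s) w i) ^ 2 <=
  size Z * \sum_(i <- s) \sum_(j <- s) w i * w j * (f i == f j).
Proof.
move=> uZ h.
pose r z := \sum_(i <- s) w i * (f i == z).
have -> : \sum_(i <- s) w i = \sum_(z <- Z) r z.
  rewrite /r exchange_big /=; apply: eq_big_seq => i is_.
  rewrite -big_distrr /= sum_mem_uniq //.
  by case: (posnP (w i)) => [->//|wi]; rewrite h ?muln1.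
apply: leq_trans (sum_cauchy1 _ _) _; rewrite leq_mul2l; apply/orP; right.
rewrite /r; under eq_bigr do rewrite -mulnn big_distrlr /=.
rewrite exchange_big /=; apply: leq_sum => i _.
rewrite exchange_big /=; apply: leq_sum => j _.
have -> : \sum_(z <- Z) w i * (f i == z) * (w j * (f j == z)) =
          w i * w j * \sum_(z <- Z) (f i == z) * (f j == z).
  rewrite big_distrr /=; apply: eq_bigr => z _.
  by rewrite mulnACA.
rewrite leq_mul2l; apply/orP; right.
case: eqP => [->|ne].
  rewrite (leq_trans _ (leq_b1 (f j \in Z))) // -(sum_mem_uniq _ uZ).
  by apply: leq_sum => z _; case: eqP.
by rewrite big1 // => z _; case: eqP => // <-; case: eqP => // e; case: ne.
Qed.

(** If a value z is taken p z times by [f] and q z times by [g], this is 2 p z q z <= (p z)^2 + (q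
    z)^2, summed over z. *)
Lemma coincidence_amgm (I J V : eqType) (s : seq I) (t : seq J)
    (f : I -> V) (g : J -> V) :
  2 * \sum_(i <- s) \sum_(j <- t) (f i == g j) <=
  \sum_(i <- s) \sum_(i' <- s) (f i == f i') +
  \sum_(j <- t) \sum_(j' <- t) (g j == g j').
Proof.
pose Z := undup (map f s ++ map g t).
have uZ : uniq Z := undup_uniq _.
pose p z := \sum_(i <- s) (f i == z).
pose q z := \sum_(j <- t) (g j == z).
have fZ : {in s, forall i, f i \in Z}.
  by move=> i is_; rewrite mem_undup mem_cat map_f.
have gZ : {in t, forall i, g i \in Z}.
  by move=> i is_; rewrite mem_undup mem_cat map_f ?orbT.
have eqp : \sum_(i <- s) \sum_(i' <- s) (f i == f i') = \sum_(z <- Z) p z ^ 2.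
  rewrite exchange_big /=.
  rewrite (eq_bigr (fun i => 1 * p (f i))); last by move=> i _; rewrite mul1n.
  rewrite (sum_fiber (fun=> 1) p uZ fZ); apply: eq_bigr => z _.
  by rewrite -mulnn; congr (_ * _); apply: eq_bigr => i _; rewrite mul1n.
have eqq : \sum_(i <- t) \sum_(i' <- t) (g i == g i') = \sum_(z <- Z) q z ^ 2.
  rewrite exchange_big /=.
  rewrite (eq_bigr (fun i => 1 * q (g i))); last by move=> i _; rewrite mul1n.
  rewrite (sum_fiber (fun=> 1) q uZ gZ); apply: eq_bigr => z _.
  by rewrite -mulnn; congr (_ * _); apply: eq_bigr => i _; rewrite mul1n.
have eqpq : \sum_(i <- s) \sum_(j <- t) (f i == g j) = \sum_(z <- Z) p z * q z.
  rewrite (eq_bigr (fun i => 1 * q (f i))); last first.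
    by move=> i _; rewrite mul1n; apply: eq_bigr => j _; rewrite eq_sym.
  rewrite (sum_fiber (fun=> 1) q uZ fZ); apply: eq_bigr => z _.
  by congr (_ * _); apply: eq_bigr => i _; rewrite mul1n.
rewrite eqp eqq eqpq -big_split big_distrr /=; apply: leq_sum => z _.
exact: nat_Cauchy.
Qed.

Lemma dyadic_split (n l : nat) (F : nat) :
  0 < n -> n < 2 ^ l -> F <= \sum_(j < l) (2 ^ j <= n < 2 ^ j.+1) * F.
Proof.
move=> n_gt0 nl; have /andP[h1 h2] := trunc_log_bounds (isT : 1 < 2) n_gt0.
have jl : trunc_log 2 n < l by rewrite -(ltn_exp2l _ _ (isT : 1 < 2))
  (leq_ltn_trans h1).
by rewrite (bigD1 (Ordinal jl)) //= h1 h2 mul1n leq_addr.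
Qed.

(** Keeping the heaviest of the l dyadic classes costs the factor l; the 4 comes from f i < 2 * 2^j.
    Zero values lie in no class and contribute nothing. *)
Lemma dyadic_class (I : Type) (s : seq I) (f : I -> nat) (l : nat) :
  0 < l -> (forall i, f i < 2 ^ l) ->
  exists j, j < l /\ \sum_(i <- s) f i ^ 2 <=
    4 * l * (size [seq i <- s | 2 ^ j <= f i < 2 ^ j.+1] * (2 ^ j) ^ 2).
Proof.
move=> l_gt0 fl.
pose c (j : 'I_l) := size [seq i <- s | 2 ^ j <= f i < 2 ^ j.+1] * (2 ^ j) ^ 2.
have hs : \sum_(i <- s) f i ^ 2 <= \sum_(j < l) 4 * c j.
  apply: (@leq_trans (\sum_(i <- s) \sum_(j < l) (2 ^ j <= f i < 2 ^ j.+1) * f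
    i ^ 2)).
    apply: leq_sum => i _; case: (posnP (f i)) => [->//|fi].
    exact: dyadic_split.
  rewrite exchange_big /=; apply: leq_sum => j _.
  rewrite /c size_filter -sum1_count [X in _ <= _ * (X * _)]big_mkcond /=.
  rewrite mulnCA big_distrl /=; apply: leq_sum => i _.
  case: andP => [[h1 h2]|]; rewrite ?mul0n // !mul1n.
  by rewrite -[4]/(2 ^ 2) -expnMn leq_sqr -expnS ltnW.
have [j _ hj] : exists2 j : 'I_l, true & \sum_(j < l) 4 * c j <= l * (4 * c j).
  have [j hj] : exists j : 'I_l, forall k, c k <= c j.
    case: (@arg_maxnP _ (Ordinal l_gt0) predT c isT) => j _ h.
    by exists j => k; apply: h.
  exists j => //; apply: leq_trans (_ : \sum_(k < l) 4 * c j <= _).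
    by apply: leq_sum => k _; rewrite leq_mul2l hj.
  by rewrite sum_nat_const card_ord.
exists j; split; first exact: ltn_ord.
apply: leq_trans hs (leq_trans hj _); rewrite /c; lia.
Qed.

(** * Incidences of lines with Cartesian products *)

(** The position of x in increasing order. For distinct entries, its quotient by [a] cuts X into
    blocks of at most a consecutive elements without sorting X. *)
Definition rank (R : realFieldType) (X : seq R) (x : R) : nat :=
  count (fun y => (y < x)%R) X.

Lemma rank_le (R : realFieldType) (X : seq R) (x y : R) :
  (x <= y)%R -> rank X x <= rank X y.
Proof. by move=> xy; apply: sub_count => z /= zx; apply: lt_le_trans xy. Qed.

Lemma rank_lt (R : realFieldType) (X : seq R) (x y : R) :
  x \in X -> (x < y)%R -> rank X x < rank X y.
Proof.
move=> xX xy; rewrite /rank.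
have : count (predU (fun z => (z < x)%R) (pred1 x)) X <= rank X y.
  apply: sub_count => z /= /orP[zx|/eqP ->//]; exact: lt_trans xy.
apply: leq_trans.
have := count_predUI (fun z => (z < x)%R) (pred1 x) X.
have -> : count (predI (fun z => (z < x)%R) (pred1 x)) X = 0.
  apply/eqP; rewrite -leqn0 leqNgt -has_count;
    apply/hasP => -[z _ /= /andP[zx /eqP zE]].
  by rewrite zE ltxx in zx.
rewrite addn0 => ->.
have h1 : 0 < count (pred1 x) X by rewrite -has_count; apply/hasP; exists x => /=.
by rewrite -[in leqLHS]addn1 leq_add2l.
Qed.

Lemma rank_lt_size (R : realFieldType) (X : seq R) (x : R) :
  x \in X -> rank X x < size X.
Proof.
move=> xX; rewrite /rank -(count_predC (fun y => (y < x)%R) X) -addn1 leq_add2l.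
by rewrite -has_count; apply/hasP; exists x => //=; rewrite ltxx.
Qed.

Lemma rank_inj (R : realFieldType) (X : seq R) : {in X &, injective (rank X)}.
Proof.
move=> x y xX yX e; case: (ltgtP x y) => // h.
  by have := rank_lt xX h; rewrite e ltnn.
by have := rank_lt yX h; rewrite e ltnn.
Qed.

Lemma rank_block (R : realFieldType) (X : seq R) (a v : nat) :
  uniq X -> 0 < a -> \sum_(x <- X) (rank X x %/ a == v) <= a.
Proof.
move=> uX a_gt0.
have -> : \sum_(x <- X) (rank X x %/ a == v) =
          size [seq x <- X | rank X x %/ a == v].
  by rewrite size_filter -sum1_count [RHS]big_mkcond.
rewrite -(size_map (rank X)) -{2}(size_iota (v * a) a).
apply: uniq_leq_size.
  rewrite map_inj_in_uniq ?filter_uniq // => x y.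
  by rewrite !mem_filter => /andP[_ xX] /andP[_ yX]; apply: rank_inj.
move=> i /mapP[x]; rewrite mem_filter => /andP[/eqP xv xX] ->.
rewrite mem_iota; have := divn_eq (rank X x) a; have := ltn_pmod (rank X x) a_gt0.
by rewrite xv; lia.
Qed.

(* A pair (m, c) stands for the line y = m x + c. *)
Definition inc (R : realFieldType) (X Y : seq R) (l : R * R) : nat :=
  \sum_(x <- X) ((l.1 * x + l.2)%R \in Y).

Definition block (R : realFieldType) (X : seq R) (a : nat) (x : R) : nat :=
  rank X x %/ a.

Definition cell_pairs (R : realFieldType) (X Y : seq R) (a b : nat)
    (l : R * R) : nat :=
  \sum_(x <- X) \sum_(x' <- X)
    [&& x != x', (l.1 * x + l.2)%R \in Y, (l.1 * x' + l.2)%R \in Y,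
        block X a x == block X a x' &
        block Y b (l.1 * x + l.2)%R == block Y b (l.1 * x' + l.2)%R].

Lemma block_le (R : realFieldType) (X : seq R) (a : nat) (x y : R) :
  (x <= y)%R -> block X a x <= block X a y.
Proof. by move=> xy; apply: leq_div2r; apply: rank_le. Qed.

(* A line of positive slope meets at most 2r - 1 cells of an r * r
   subdivision of the grid. *)
Lemma inc_cell_pairs (R : realFieldType) (X Y : seq R) (a b r : nat)
    (l : R * R) :
  uniq X -> (0 < l.1)%R ->
  {in X, forall x, block X a x < r} -> {in Y, forall y, block Y b y < r} ->
  0 < r -> 2 * (r.*2.-1) <= inc X Y l ->
  inc X Y l ^ 2 <= 4 * r * cell_pairs X Y a b l.
Proof.
move=> uX l_gt0 hX hY r_gt0 hr.
pose f (x : R) := (l.1 * x + l.2)%R.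
have fle x y : ((f x <= f y) = (x <= y))%R by rewrite /f lerD2r ler_pM2l.
(* Along a line of positive slope both block indices are nondecreasing, so their sum already
   identifies the cell; it takes at most 2r - 1 values. *)
pose h x := block X a x + block Y b (f x).
have key x y : (x <= y)%R -> h x = h y ->
    block X a x = block X a y /\ block Y b (f x) = block Y b (f y).
  move=> xy; have := block_le X a xy.
  have : block Y b (f x) <= block Y b (f y) by apply: block_le; rewrite fle.
  by rewrite /h; lia.
have h1 : inc X Y l ^ 2 <= size (iota 0 (r.*2.-1)) *
  \sum_(i <- X) \sum_(j <- X) (f i \in Y) * (f j \in Y) * (h i == h j).
  apply: (collision (w := fun x => nat_of_bool (f x \in Y)));
    first exact: iota_uniq.
  move=> x xX; rewrite lt0b => fY; rewrite mem_iota /=.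
  by have := hX x xX; have := hY _ fY; rewrite /h; lia.
rewrite size_iota in h1.
have h2 : \sum_(i <- X) \sum_(j <- X) (f i \in Y) * (f j \in Y) * (h i == h j)
   <= inc X Y l + cell_pairs X Y a b l.
  rewrite /inc /cell_pairs -big_split /=; apply: leq_sum_seq => x xX.
  rewrite -/(f x).
  have e1 : nat_of_bool (f x \in Y) = \sum_(x' <- X) (f x \in Y) * (x == x').
    by rewrite -big_distrr /= sum_mem_uniq // xX muln1.
  rewrite [X in _ <= X + _]e1 -big_split /=; apply: leq_sum => y _.
  case: (boolP (f x \in Y)) => xY; last by rewrite !mul0n.
  case: (boolP (f y \in Y)) => yY; last by rewrite mul0n.
  rewrite !mul1n -/(f y).
  case: (eqVneq x y) => [->|xy]; first by rewrite eqxx.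
  case: eqP => // e.
  have [-> ->] : block X a x = block X a y /\ block Y b (f x) = block Y b (f y).
    by case: (leP x y) => [/key|/ltW/key h0]; [apply | case: (h0 (esym e))].
  by rewrite !eqxx.
have h3 := leq_trans h1 (leq_mul (leqnn _) h2).
(* Here i^2 <= (2r - 1)(i + J). Since 2(2r - 1) <= i, the diagonal part is at most i^2 / 2 and is
   absorbed. *)
move: h3 hr; move: (inc X Y l) (cell_pairs _ _ _ _ _) => i J h3 hr; nia.
Qed.

Lemma inc_le_l (R : realFieldType) (X Y : seq R) (l : R * R) : inc X Y l <=
  size X.
Proof.
rewrite -[size X]muln1 -(sum_const_seq X 1); apply: leq_sum => x _; exact: leq_b1.
Qed.

Lemma inc_le_r (R : realFieldType) (X Y : seq R) (l : R * R) :
  uniq X -> l.1 != 0%R -> inc X Y l <= size Y.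
Proof.
move=> uX l0; have -> : inc X Y l = size [seq (l.1 * x + l.2)%R | x <- X & (l.1
  * x + l.2)%R \in Y].
  by rewrite size_map size_filter -sum1_count [RHS]big_mkcond.
apply: uniq_leq_size.
  rewrite map_inj_uniq ?filter_uniq // => x y /addIr; exact: mulfI.
by move=> y /mapP[x]; rewrite mem_filter => /andP[h _] ->.
Qed.

Lemma sum_block_pairs (R : realFieldType) (X : seq R) (a : nat) :
  uniq X -> 0 < a ->
  \sum_(x <- X) \sum_(x' <- X) (block X a x == block X a x') <= size X * a.
Proof.
move=> uX a0; rewrite -sum_const_seq; apply: leq_sum => x _.
under eq_bigr do rewrite eq_sym.
exact: rank_block.
Qed.

(* Two points with distinct abscissas lie on at most one line. *)
Lemma sum_cell_pairs (R : realFieldType) (X Y : seq R) (a b : nat)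
    (Ls : seq (R * R)) :
  uniq X -> uniq Y -> uniq Ls -> 0 < a -> 0 < b ->
  \sum_(l <- Ls) cell_pairs X Y a b l <= (size X * a) * (size Y * b).
Proof.
move=> uX uY uL a0 b0.
pose on (l : R * R) (x x' y y' : R) :=
  [&& x != x', y == (l.1 * x + l.2)%R & y' == (l.1 * x' + l.2)%R].
pose BX x x' := block X a x == block X a x'.
pose BY y y' := block Y b y == block Y b y'.
apply: (@leq_trans (\sum_(x <- X) \sum_(x' <- X) \sum_(y <- Y) \sum_(y' <- Y)
   (BX x x') * (BY y y') * \sum_(l <- Ls) on l x x' y y')).
  rewrite /cell_pairs exchange_big /=; apply: leq_sum => x _.
  rewrite exchange_big /=; apply: leq_sum => x' _.
  apply: (@leq_trans (\sum_(l <- Ls) \sum_(y <- Y) \sum_(y' <- Y)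
     (BX x x') * (BY y y') * on l x x' y y')); last first.
    rewrite exchange_big /=; apply: leq_sum => y _.
    rewrite exchange_big /=; apply: leq_sum => y' _.
    by rewrite big_distrr.
  apply: leq_sum => l _.
  case: and5P => [[xx' yY y'Y bx by_]|_] //.
  rewrite (bigD1_seq _ yY uY) /= (bigD1_seq _ y'Y uY) /=.
  by rewrite /BX /BY /on bx by_ xx' !eqxx -addnA leq_addr.
apply: leq_trans (_ : (\sum_(x <- X) \sum_(x' <- X) BX x x') *
   (\sum_(y <- Y) \sum_(y' <- Y) BY y y') <= _); last first.
  by apply: leq_mul; apply: sum_block_pairs.
rewrite big_distrl /=; apply: leq_sum => x _.
rewrite big_distrl /=; apply: leq_sum => x' _.
rewrite big_distrr /=; apply: leq_sum => y _.
rewrite big_distrr /=; apply: leq_sum => y' _.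
rewrite -[leqRHS]muln1 leq_mul2l; apply/orP; right.
apply: sum_eq_le1 => // l l' _ _ /and3P[xx' /eqP e1 /eqP e2] /and3P[_ /eqP e3
  /eqP e4].
have e5 : (l.1 * (x - x') = l'.1 * (x - x'))%R.
  by rewrite !mulrBr; lra.
have e6 : l.1 = l'.1 by apply: (mulIf _ e5); rewrite subr_eq0.
have e7 : l.2 = l'.2 by move: e3; rewrite e1 e6 => /addrI.
by move: e6 e7; case: (l) (l') => [? ?] [? ?] /= -> ->.
Qed.

Lemma subdivision (n r : nat) : 0 < r -> r <= n ->
  exists a, [/\ 0 < a, r * a <= 2 * n & forall k, k < n -> k %/ a < r].
Proof.
move=> r0 rn; exists (n.-1 %/ r).+1; split=> //.
  have := leq_divM n.-1 r; lia.
move=> k kn; rewrite ltn_divLR //.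
have := ltn_ceil n.-1 r0; lia.
Qed.

(** With r proportional to the richness 2^j, each inc^3 is at most 32 r^2 times the number of pairs
    of points of the line in a common cell, and all lines together have at most 4 (|X| |Y|)^2 / r^2
    such pairs: r cancels. *)
Lemma rich_class (R : realFieldType) (X Y : seq R) (Ls : seq (R * R)) (j : nat) :
  uniq X -> uniq Y -> uniq Ls -> 0 < j ->
  {in Ls, forall l, (0 < l.1)%R /\ 2 ^ j <= inc X Y l < 2 ^ j.+1} ->
  \sum_(l <- Ls) inc X Y l ^ 3 <= 128 * (size X * size Y) ^ 2.
Proof.
move=> uX uY uL j0 hL.
case: Ls uL hL => [|l0 Ls0] uL hL; first by rewrite big_nil.
have [l0_gt0 /andP[hj0 _]] := hL l0 (mem_head _ _).
move: (l0 :: Ls0) uL hL => Ls uL hL.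
(* For j = 1 the truncated subtraction gives r = 1, and 2(2r - 1) <= 2^j holds with equality. *)
pose r := 2 ^ (j - 2).
have r0 : 0 < r by rewrite expn_gt0.
have [hr1 hr2] : 2 * (r.*2.-1) <= 2 ^ j /\ 2 ^ j.+1 <= 8 * r.
  rewrite /r; case: (j) j0 => [//|[//|k]] _.
  rewrite !subSS subn0 !expnS; have := expn_gt0 2 k; lia.
have rj : r <= 2 ^ j by rewrite leq_exp2l // leq_subr.
have rX : r <= size X by apply: leq_trans (leq_trans rj hj0) (inc_le_l _ _ _).
have rY : r <= size Y.
  by apply: leq_trans (leq_trans rj hj0) (inc_le_r _ uX _); rewrite gt_eqF.
have [a [a0 ha fa]] := subdivision r0 rX.
have [b [b0 hb fb]] := subdivision r0 rY.
apply: (@leq_trans (\sum_(l <- Ls) 32 * r ^ 2 * cell_pairs X Y a b l)).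
  apply: leq_sum_seq => l lL; have [l_gt0 /andP[h1 h2]] := hL l lL.
  have h3 : inc X Y l ^ 2 <= 4 * r * cell_pairs X Y a b l.
    apply: inc_cell_pairs => //; last exact: leq_trans h1.
      by move=> x xX; apply: fa; apply: rank_lt_size.
    by move=> x xX; apply: fb; apply: rank_lt_size.
  rewrite expnSr mulnC; apply: leq_trans (leq_mul (leqnn (inc X Y l)) h3) _.
  have : inc X Y l <= 8 * r by apply: leq_trans hr2; apply: ltnW.
  move=> h4; apply: leq_trans (leq_mul h4 (leqnn _)) _; lia.
rewrite -big_distrr /=.
apply: leq_trans (leq_mul (leqnn _) (sum_cell_pairs uX uY uL a0 b0)) _.
have := leq_mul ha hb; move: (size X) (size Y) => m n hm.
have := leq_mul (leqnn (32 * (m * n))) hm; lia.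
Qed.

(* The term [size Ls] accounts for the lines with a single incidence. *)
Lemma szemeredi_trotter_grid (R : realFieldType) (X Y : seq R)
    (Ls : seq (R * R)) (d : nat) :
  uniq X -> uniq Y -> uniq Ls -> {in Ls, forall l, (0 < l.1)%R} ->
  size X < 2 ^ d ->
  \sum_(l <- Ls) inc X Y l ^ 3 <= size Ls + 128 * d * (size X * size Y) ^ 2.
Proof.
move=> uX uY uL hL Xd.
pose c (j : nat) l := 2 ^ j <= inc X Y l < 2 ^ j.+1.
apply: (@leq_trans (\sum_(l <- Ls) (1 + \sum_(j < d) (0 < j) * (c j l * inc X Y
  l ^ 3)))).
  apply: leq_sum => l _; case: (posnP (inc X Y l)) => [->|i0]; first by [].
  have := dyadic_split (inc X Y l ^ 3) i0 (leq_ltn_trans (inc_le_l _ _ _) Xd).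
  move=> h; apply: leq_trans h _.
  case: (d) => [|d']; first by rewrite big_ord0.
  rewrite !big_ord_recl /= mul0n add0n leq_add //.
    by case: (inc X Y l) => [|[|i]].
  by apply: leq_sum => i _; rewrite mul1n.
rewrite big_split sum_const_seq muln1 leq_add2l exchange_big /=.
apply: (@leq_trans (\sum_(j < d) 128 * (size X * size Y) ^ 2)); last first.
  by rewrite sum_nat_const card_ord mulnCA mulnA.
apply: leq_sum => j _; case: (posnP j) => [->|j0]; first by rewrite big1.
have := @rich_class _ X Y [seq l <- Ls | c j l] j uX uY (filter_uniq _ uL) j0.
rewrite big_filter big_mkcond /= => h.
apply: leq_trans (h _); last first.
  by move=> l; rewrite mem_filter => /andP[cl lL]; split=> //; apply: hL.
by apply: leq_sum => l _; case: (c j l); rewrite ?mul1n.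
Qed.

(** * Energies and representation functions *)

Definition pairs (T U : Type) (s : seq T) (t : seq U) : seq (T * U) :=
  [seq (x, y) | x <- s, y <- t].

Lemma sum_pairs (T U : Type) (s : seq T) (t : seq U) (F : T * U -> nat) :
  \sum_(p <- pairs s t) F p = \sum_(x <- s) \sum_(y <- t) F (x, y).
Proof. exact: big_allpairs. Qed.

Lemma size_pairs (T U : Type) (s : seq T) (t : seq U) :
  size (pairs s t) = size s * size t.
Proof. exact: size_allpairs. Qed.

Lemma mem_pairs (T U : eqType) (s : seq T) (t : seq U) (p : T * U) :
  (p \in pairs s t) = (p.1 \in s) && (p.2 \in t).
Proof.
by case: p => x y; apply/allpairsP/andP=> [[[a b] /= [? ? [-> ->]]]|[]] //;
  exists (x, y).
Qed.

Lemma pairs_uniq (T U : eqType) (s : seq T) (t : seq U) :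
  uniq s -> uniq t -> uniq (pairs s t).
Proof. by move=> us ut;
  apply: allpairs_uniq => // -[a b] [a' b'] _ _ /= [-> ->]. Qed.

Definition intercept (R : realFieldType) (lam : R) (p : R * R) : R :=
  (p.2 - lam * p.1)%R.

Lemma sum_intercept (R : realFieldType) (X Y : seq R) (l : R * R) :
  uniq Y -> \sum_(p <- pairs X Y) (intercept l.1 p == l.2) = inc X Y l.
Proof.
move=> uY; rewrite sum_pairs; apply: eq_bigr => x _.
rewrite -sum_mem_uniq //; apply: eq_bigr => y _.
by rewrite /intercept /= subr_eq eq_sym addrC.
Qed.

(* The additive energy of X and lam X, in terms of lines of slope lam. *)
Definition dilate_energy (R : realFieldType) (X : seq R) (lam : R) : nat :=
  \sum_(p <- pairs X X) \sum_(q <- pairs X X)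
    (intercept lam p == intercept lam q).

(** Each point of X * X lies on one line of slope lam, so the energy is the sum over the points of
    the richness of that line. Cauchy--Schwarz over slopes and points separates the weights from the
    squared richness; summed over points, the latter is the third moment over lines, bounded by
    Szemeredi--Trotter. *)
Lemma sum_dilate_energy (R : realFieldType) (X Lam : seq R) (w : R -> nat)
    (d : nat) :
  uniq X -> uniq Lam -> {in Lam, forall lam, (0 < lam)%R} -> size X < 2 ^ d ->
  (\sum_(lam <- Lam) w lam * dilate_energy X lam) ^ 2 <=
  (\sum_(lam <- Lam) w lam ^ 2) * size X ^ 2 *
    (size Lam * size X ^ 2 + 128 * d * size X ^ 4).
Proof.
move=> uX uL L0 Xd.
pose T := pairs Lam (pairs X X).
pose f (t : R * (R * R)) := (t.1, intercept t.1 t.2).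
have -> : \sum_(lam <- Lam) w lam * dilate_energy X lam =
          \sum_(t <- T) w t.1 * inc X X (f t).
  rewrite sum_pairs; apply: eq_bigr => lam _; rewrite big_distrr /=.
  apply: eq_bigr => p _; rewrite -sum_intercept //; congr (_ * _).
  by apply: eq_bigr => q _; rewrite eq_sym.
apply: leq_trans (sum_cauchy _ _ _) _.
have -> : \sum_(t <- T) w t.1 ^ 2 = (\sum_(lam <- Lam) w lam ^ 2) * size X ^ 2.
  rewrite sum_pairs big_distrl /=; apply: eq_bigr => lam _.
  by rewrite sum_const_seq size_pairs mulnn mulnC.
rewrite leq_mul2l; apply/orP; right.
pose Z := undup (map f T).
have uZ : uniq Z := undup_uniq _.
have fZ : {in T, forall t, f t \in Z} by move=> t tT; rewrite mem_undup map_f.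
rewrite (eq_bigr (fun t => 1 * inc X X (f t) ^ 2)); last by move=> t _;
  rewrite mul1n.
rewrite (sum_fiber (fun=> 1) (fun l => inc X X l ^ 2) uZ fZ).
have Z0 : {in Z, forall l, l.1 \in Lam}.
  by move=> l; rewrite mem_undup => /mapP[t]; rewrite mem_pairs => /andP[? _] ->.
apply: (@leq_trans (\sum_(l <- Z) inc X X l ^ 3)).
  apply: leq_sum_seq => l lZ; rewrite expnS leq_mul2r; apply/orP; right.
  rewrite -(sum_intercept _ _ uX) [leqLHS]sum_pairs.
  rewrite (bigD1_seq _ (Z0 l lZ) uL) /= [X in _ + X]big1 ?addn0; last first.
    move=> lam /negPf h; rewrite big1 // => p _.
    by rewrite mul1n -pair_eqE /= /pair_eq /= h.
  by apply: leq_sum => p _; rewrite mul1n -pair_eqE /= /pair_eq /= eqxx.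
apply: leq_trans (szemeredi_trotter_grid uX uX uZ _ Xd) _.
  by move=> l /Z0/L0.
have : size Z <= size T by apply: leq_trans (size_undup _) _; rewrite size_map.
by rewrite /T !size_pairs !mulnn -expnM leq_add2r.
Qed.

Definition diff_rep (R : realFieldType) (X Y : seq R) (z : R) : nat :=
  \sum_(y <- Y) ((z + y)%R \in X).

(* Writing z + c as p * w, the pair (w, c) lies on the line of slope p and
   intercept -z. *)
Lemma sum_diff_rep_cube (R : realFieldType) (X C W P Z : seq R) (t d : nat) :
  uniq C -> uniq W -> uniq P -> uniq Z -> {in P, forall p, (0 < p)%R} ->
  {in X, forall x, t <= \sum_(p <- P) \sum_(w <- W) ((p * w)%R == x)} ->
  size W < 2 ^ d ->
  t ^ 3 * \sum_(z <- Z) diff_rep X C z ^ 3 <=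
  size P ^ 2 * (size P * size Z + 128 * d * (size W * size C) ^ 2).
Proof.
move=> uC uW uP uZ P0 ht Wd.
have key z : t * diff_rep X C z <= \sum_(p <- P) inc W C (p, - z)%R.
  have -> : \sum_(p <- P) inc W C (p, - z)%R =
            \sum_(c <- C) \sum_(p <- P) \sum_(w <- W) ((p * w)%R == (z + c)%R).
    rewrite [RHS]exchange_big /=; apply: eq_bigr => p _.
    rewrite [RHS]exchange_big /=; apply: eq_bigr => w _.
    rewrite -sum_mem_uniq //; apply: eq_bigr => c _.
    by rewrite /= subr_eq addrC eq_sym eq_sym.
  rewrite /diff_rep big_distrr /=; apply: leq_sum => c _.
  by case: (boolP (_ \in X)) => [/ht|]; rewrite ?muln1 ?muln0.
apply: (@leq_trans (\sum_(z <- Z) size P ^ 2 * \sum_(p <- P) inc W C (p, - z)%R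
  ^ 3)).
  rewrite big_distrr /=; apply: leq_sum => z _; rewrite -expnMn.
  by apply: leq_trans (sum_cube _ _); rewrite leq_exp2r.
rewrite -big_distrr leq_mul2l; apply/orP; right.
rewrite exchange_big /=.
have -> : \sum_(p <- P) \sum_(z <- Z) inc W C (p, - z)%R ^ 3 =
          \sum_(l <- pairs P (map -%R Z)%R) inc W C l ^ 3.
  by rewrite sum_pairs; apply: eq_bigr => p _; rewrite big_map.
have uL : uniq (pairs P (map -%R Z)%R).
  by apply: pairs_uniq; rewrite // map_inj_uniq //; apply: oppr_inj.
apply: leq_trans (szemeredi_trotter_grid uW uC uL _ Wd) _.
  by move=> l; rewrite mem_pairs => /andP[/P0].
by rewrite size_pairs size_map.
Qed.

Lemma leq_sum_subset (I : eqType) (s t : seq I) (F : I -> nat) :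
  uniq s -> {subset s <= t} -> \sum_(i <- s) F i <= \sum_(i <- t) F i.
Proof.
move=> us st.
apply: (@leq_trans (\sum_(i <- undup t) F i)); last first.
  elim: t {st} => //= a t IH; case: ifP => _; rewrite !big_cons ?leq_add2l //.
  exact: leq_trans IH (leq_addl _ _).
have hp : perm_eq s [seq i <- undup t | i \in s].
  apply: uniq_perm; rewrite ?filter_uniq ?undup_uniq // => i.
  by rewrite mem_filter mem_undup; case: (boolP (i \in s)) => // /st ->.
rewrite (perm_big _ hp) big_filter big_mkcond /=.
by apply: leq_sum => i _; case: ifP.
Qed.

Definition quotients (R : realFieldType) (A : seq R) : seq R :=
  undup [seq (x / y)%R | x <- A, y <- A].

Lemma quotient_mem (R : realFieldType) (A : seq R) (x y : R) :
  x \in A -> y \in A -> (x / y)%R \in quotients A.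
Proof. by move=> xA yA; rewrite mem_undup; apply/allpairsP; exists (x, y). Qed.

Lemma quotientsP (R : realFieldType) (A : seq R) (z : R) :
  z \in quotients A -> exists x y, [/\ x \in A, y \in A & z = (x / y)%R].
Proof. by rewrite mem_undup => /allpairsP[[x y] /= [? ? ->]]; exists x, y. Qed.

Lemma size_quotients (R : realFieldType) (A : seq R) :
  size (quotients A) <= size A ^ 2.
Proof. by apply: leq_trans (size_undup _) _; rewrite size_allpairs mulnn. Qed.

Definition quot_rep (R : realFieldType) (A : seq R) (z : R) : nat :=
  \sum_(x <- A) ((z * x)%R \in A).

Definition mul_energy (R : realFieldType) (A : seq R) : nat :=
  \sum_(z <- quotients A) quot_rep A z ^ 2.

(* A coincidence a b = a' b' determines the slope lam = b' / b = a / a'; writing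
   b and b' as sums of elements of al B1 and be B2 then gives two points on
   lines of slope lam, counted by [dilate_energy]. *)
Lemma few_sums_many_products (R : realFieldType) (A B B1 B2 AB : seq R)
    (al be : R) (t d : nat) :
  uniq A -> uniq B1 -> uniq B2 -> uniq AB ->
  {in A, forall x, (0 < x)%R} -> {subset B <= A} ->
  {in A & B, forall x y, (x * y)%R \in AB} ->
  al != 0%R -> be != 0%R -> 0 < d ->
  size B <= 2 * t -> size B1 <= 2 * t -> size B2 <= 2 * t -> 
  size B1 < 2 ^ d -> size B2 < 2 ^ d -> t <= size B1 -> t <= size B2 ->
  (size A * \sum_(p <- pairs B1 B2) ((al * p.1 + be * p.2)%R \in B)) ^ 4 <=
  size AB ^ 2 * (64 * 129 * d * mul_energy A * t ^ 6).
Proof.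
move=> uA u1 u2 uAB A0 BA hAB al0 be0 d0 Bt B1t B2t B1d B2d tB1 tB2.
have B0 : {in B, forall x, (0 < x)%R} by move=> x /BA/A0.
pose u (p : R * R) := (al * p.1 + be * p.2)%R.
pose L := quotients B.
pose r := quot_rep A.
pose C := \sum_(lam <- L) r lam *
  \sum_(p <- pairs B1 B2) \sum_(q <- pairs B1 B2) (u q == lam * u p)%R.
have h1 : (size A * \sum_(p <- pairs B1 B2) (u p \in B)) ^ 2 <= size AB * C.
  have := @collision _ _ (pairs A (pairs B1 B2)) AB
    (fun i => i.1 * u i.2)%R (fun i => nat_of_bool (u i.2 \in B)) uAB _.
  have -> : \sum_(i <- pairs A (pairs B1 B2)) (u i.2 \in B) =
            size A * \sum_(p <- pairs B1 B2) (u p \in B).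
    by rewrite sum_pairs /= sum_const_seq.
  move=> h; apply: leq_trans (h _) _ => [i|].
    by rewrite mem_pairs lt0b => /andP[iA _] uB; apply: hAB.
  rewrite leq_mul2l; apply/orP; right.
  apply: (@leq_trans (\sum_(a <- A) \sum_(p <- pairs B1 B2) \sum_(a' <- A)
     \sum_(q <- pairs B1 B2) \sum_(lam <- L) (a == lam * a')%R * (u q == lam *
       u p)%R)).
    rewrite sum_pairs; apply: leq_sum_seq => a aA; apply: leq_sum => p _.
    rewrite sum_pairs; apply: leq_sum_seq => a' a'A; apply: leq_sum => q _ /=.
    case: (boolP (u p \in B)) => // upB; case: (boolP (u q \in B)) => // uqB.
    case: eqP => //= e; rewrite !mul1n.
    have lL : (u q / u p)%R \in L by apply: quotient_mem.
    have up0 : u p != 0%R by rewrite gt_eqF // B0.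
    rewrite (bigD1_seq _ lL (undup_uniq _)) /=.
    have -> : (a == u q / u p * a')%R.
      by apply/eqP; apply: (mulIf up0); rewrite e; field.
    by rewrite divfK // eqxx.
  rewrite [leqLHS](_ : _ = C) //.
  rewrite /C.
  transitivity (\sum_(lam <- L) \sum_(a <- A) \sum_(p <- pairs B1 B2) \sum_(a'
    <- A)
     \sum_(q <- pairs B1 B2) (a == lam * a')%R * (u q == lam * u p)%R).
    rewrite [RHS]exchange_big /=; apply: eq_bigr => a _.
    rewrite [RHS]exchange_big /=; apply: eq_bigr => p _.
    rewrite [RHS]exchange_big /=; apply: eq_bigr => a' _.
    by rewrite [RHS]exchange_big.
  apply: eq_bigr => lam _.
  have -> : r lam = \sum_(a <- A) \sum_(a' <- A) (a == lam * a')%R.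
    rewrite exchange_big /=; apply: eq_bigr => a _.
    by rewrite -(sum_mem_uniq _ uA); apply: eq_bigr => x _; rewrite eq_sym.
  rewrite big_distrl /=; apply: eq_bigr => a _.
  rewrite exchange_big big_distrl /=; apply: eq_bigr => a' _.
  rewrite big_distrr /=; apply: eq_bigr => p _.
  by rewrite big_distrr.
pose W X := \sum_(lam <- L) r lam * dilate_energy X lam.
(* The relation u q = lam u p reads al (q.1 - lam p.1) = - be (q.2 - lam p.2): an intercept from B1
   * B1 against one from B2 * B2. The mixed count splits into the two energies. *)
have h2 : 2 * C <= W B1 + W B2.
  rewrite /C /W -big_split big_distrr /=; apply: leq_sum => lam _.
  rewrite -mulnDr mulnCA leq_mul2l; apply/orP; right.
  have := @coincidence_amgm _ _ _ (pairs B1 B1) (pairs B2 B2)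
    (fun p => al * intercept lam p)%R (fun p => - be * intercept lam p)%R.
  have nbe0 : (- be)%R != 0%R by rewrite oppr_eq0.
  under [X in _ <= X + _ -> _]eq_bigr do under eq_bigr do rewrite (inj_eq
    (mulfI al0)).
  under [X in _ <= _ + X -> _]eq_bigr do under eq_bigr do rewrite (inj_eq
    (mulfI nbe0)).
  apply: leq_trans; rewrite leq_mul2l /=.
  rewrite !sum_pairs; under eq_bigr do under eq_bigr do rewrite sum_pairs.
  under [leqRHS]eq_bigr do under eq_bigr do rewrite sum_pairs.
  apply: leq_sum => x _; rewrite exchange_big /=.
  apply: leq_sum => x' _; apply: leq_sum => y _; apply: leq_sum => y' _.
  rewrite /u /intercept /=; case: eqP => // e; case: eqP => // e'.
  by case: e'; move: e => /=; lra.
have L0 : {in L, forall lam, (0 < lam)%R}.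
  by move=> lam /quotientsP[x [y [xB yB ->]]]; rewrite divr_gt0 // B0.
(* From |X| <= 2t come the powers of 2, with product 4 * 16 = 64, and 129 d absorbs 1 + 128 d. *)
have hW X : uniq X -> size X <= 2 * t -> size X < 2 ^ d -> t <= size X ->
    W X ^ 2 <= 64 * 129 * d * mul_energy A * t ^ 6.
  move=> uX Xt Xd tX.
  have := sum_dilate_energy r uX (undup_uniq _) L0 Xd.
  have hE : \sum_(lam <- L) r lam ^ 2 <= mul_energy A.
    apply: leq_sum_subset; first exact: undup_uniq.
    by move=> lam /quotientsP[x [y [xB yB ->]]]; apply: quotient_mem; apply: BA.
  have X2 : size X ^ 2 <= 4 * t ^ 2 by rewrite -[4]/(2 ^ 2) -expnMn leq_sqr.
  have hL : size L <= 4 * t ^ 2.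
    apply: leq_trans (size_quotients _) _.
    by rewrite -[4]/(2 ^ 2) -expnMn leq_sqr.
  have X4 : size X ^ 4 <= 16 * t ^ 4.
    by rewrite (expnM _ 2 2) -[16]/(4 ^ 2) (expnM t 2 2) -expnMn leq_sqr.
  move=> h; apply: leq_trans h _.
  have h3 := leq_mul (leq_mul hE X2) (leq_add (leq_mul hL X2) (leq_mul (leqnn
    (128 * d)) X4)).
  apply: leq_trans h3 _.
  have : 1 <= d by []. move: (mul_energy A) => E hd.
  have -> : 64 * 129 * d * E * t ^ 6 = E * (4 * t ^ 2) * (129 * d * 16 * t ^ 4)
    by ring.
  rewrite leq_mul2l; apply/orP; right.
  have := leq_mul hd (leqnn (16 * t ^ 4)); lia.
have C2 : C ^ 2 <= 64 * 129 * d * mul_energy A * t ^ 6.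
  have := hW _ u1 B1t B1d tB1; have := hW _ u2 B2t B2d tB2.
  move: (64 * 129 * d * _ * _) (W B1) (W B2) h2 => M a b ab.
  case: (leqP a b) => [|/ltnW] le_ab b2 a2.
    by apply: leq_trans b2; rewrite leq_sqr; lia.
  by apply: leq_trans a2; rewrite leq_sqr; lia.
rewrite (expnM _ 2 2); apply: leq_trans (_ : (size AB * C) ^ 2 <= _).
  by rewrite leq_sqr.
by rewrite expnMn leq_mul2l C2 orbT.
Qed.

(** * Coincidences of vector sums *)

(* Coincidences between vector sums of points of A * A on the lines through
   the origin of slopes l1, l2 and on those of slopes l3, l4. *)
Definition vec_coinc (R : realFieldType) (A : seq R) (l1 l2 l3 l4 : R) : nat :=
  \sum_(p <- pairs A A) \sum_(q <- pairs A A)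
    ((l1 * p.1)%R \in A) * ((l2 * p.2)%R \in A) *
    (((l3 * q.1)%R \in A) * ((l4 * q.2)%R \in A)) *
    ((p.1 + p.2, l1 * p.1 + l2 * p.2)%R == (q.1 + q.2, l3 * q.1 + l4 * q.2)%R).

Lemma sum_pair_weights (R : realFieldType) (A : seq R) (l1 l2 : R) :
  \sum_(p <- pairs A A) ((l1 * p.1)%R \in A) * ((l2 * p.2)%R \in A) =
  quot_rep A l1 * quot_rep A l2.
Proof. by rewrite sum_pairs big_distrlr. Qed.

(** The first vector sum has slope above l1, the second has slope below l4. *)
Lemma vec_coinc_slopes (R : realFieldType) (A : seq R) (l1 l2 l3 l4 : R) :
  {in A, forall x, (0 < x)%R} -> (l1 < l2)%R -> (l3 < l4)%R ->
  (l4 <= l1)%R -> vec_coinc A l1 l2 l3 l4 = 0.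
Proof.
move=> A0 l12 l34 l41; rewrite /vec_coinc big_seq big1 // => p pA.
rewrite big_seq big1 // => q qA; case: eqP; rewrite ?muln0 // => -[e1 e2].
move: pA qA; rewrite !mem_pairs => /andP[/A0 p1 /A0 p2] /andP[/A0 q1 /A0 q2].
have h1 : (l1 * (p.1 + p.2) < l1 * p.1 + l2 * p.2)%R.
  by rewrite mulrDr ltrD2l ltr_pM2r.
have h2 : (l3 * q.1 + l4 * q.2 < l4 * (q.1 + q.2))%R.
  by rewrite mulrDr ltrD2r ltr_pM2r.
have h3 : (l4 * (q.1 + q.2) <= l1 * (p.1 + p.2))%R.
  by rewrite e1 ler_pM2r // addr_gt0.
by have := lt_trans (le_lt_trans h3 h1) (eq_ind _ (fun z => (z < _)%R) h2 _
  (esym e2)); rewrite ltxx.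
Qed.

Lemma vec_coinc_sym (R : realFieldType) (A : seq R) (l1 l2 l3 l4 : R) :
  vec_coinc A l1 l2 l3 l4 = vec_coinc A l3 l4 l1 l2.
Proof.
rewrite /vec_coinc exchange_big /=; apply: eq_bigr => q _; apply: eq_bigr => p _.
by rewrite eq_sym [X in X * _]mulnC.
Qed.

(** Vectors of distinct slopes are independent, so a sum determines its two summands. *)
Lemma vec_coinc_diag (R : realFieldType) (A : seq R) (l1 l2 : R) :
  uniq A -> l1 != l2 -> vec_coinc A l1 l2 l1 l2 <= quot_rep A l1 * quot_rep A l2.
Proof.
move=> uA l12; rewrite -sum_pair_weights /vec_coinc; apply: leq_sum => p _.
apply: (@leq_trans (\sum_(q <- pairs A A) ((l1 * p.1)%R \in A) * ((l2 * p.2)%R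
  \in A) * (p == q))); last first.
  rewrite -big_distrr /= sum_mem_uniq ?pairs_uniq //.
  by rewrite -[leqRHS]muln1 leq_mul2l leq_b1 orbT.
apply: leq_sum => q _; case: eqP => [[e1 e2]|]; last by rewrite muln0.
have -> : p = q.
  have e3 : ((l2 - l1) * p.2 = (l2 - l1) * q.2)%R.
    have : (l1 * (p.1 + p.2) = l1 * (q.1 + q.2))%R by rewrite e1.
    lra.
  have e4 : p.2 = q.2 by apply: (mulfI _ e3); rewrite subr_eq0 eq_sym.
  have e5 : p.1 = q.1 by move: e1; rewrite e4 => /addIr.
  by case: (p) (q) e4 e5 => [? ?] [? ?] /= -> ->.
by rewrite eqxx !muln1 -[leqRHS]muln1 leq_mul2l; apply/orP; right;
  case: (_ \in _); case: (_ \in _).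
Qed.

(* Pairs of slopes whose indices differ by at most M play the role of the
   clusters of consecutive lines of Konyagin and Shkredov: a vector sum has a
   slope strictly between those of its summands, so each pair can only
   interact with O(M^2) others. *)
Lemma many_coincidences (R : realFieldType) (A S s : seq R) (t M : nat) :
  uniq A -> uniq S -> {in A, forall x, (0 < x)%R} ->
  {in A &, forall x y, (x + y)%R \in S} ->
  sorted <%R%R s -> {in s, forall l, t <= quot_rep A l} ->
  0 < t -> 0 < M -> 2 * M <= size s ->
  4 * size S ^ 2 <= size s * M * t ^ 2 ->
  1 < M /\ exists l1 l2 l3 l4,
    [/\ [/\ l1 \in s, l2 \in s, l3 \in s & l4 \in s],
        (l1 < l2)%R, (l3 < l4)%R, (l1, l2) != (l3, l4) &
        size s * t ^ 4 < 32 * size S ^ 2 * M * vec_coinc A l1 l2 l3 l4].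
Proof.
move=> uA uS A0 hS ss hs t0 M0 Mn hM.
set n := size s in Mn hM *; set sg := size S in hM *.
have nE : size s = n by [].
clearbody n.
pose lam i := nth 0%R s i.
have lam_lt i j : i < j -> j < n -> (lam i < lam j)%R.
  by move=> ij jn; apply: (sorted_ltn_nth lt_trans) => //; rewrite inE nE //;
    apply: ltn_trans jn.
pose Q l1 l2 l3 l4 := vec_coinc A l1 l2 l3 l4.
pose big l1 l2 l3 l4 := n * t ^ 4 < 32 * sg ^ 2 * M * Q l1 l2 l3 l4.
have [|hno] := boolP ((1 < M) && has (fun p : R * R => has (fun q : R * R =>
    [&& (p.1 < p.2)%R, (q.1 < q.2)%R, p != q & big p.1 p.2 q.1 q.2]) (pairs s
      s)) (pairs s s)).
  move=> /andP[M1 /hasP[p ps /hasP[q qs /and4P[h1 h2 h3 h4]]]].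
  split=> //; exists p.1, p.2, q.1, q.2.
  move: ps qs; rewrite !mem_pairs => /andP[-> ->] /andP[-> ->].
  by split=> //; move: h3; case: (p) (q) => [? ?] [? ?].
exfalso.
(* An entry (i, k) stands for the lines of indices i and i + k + 1; the bound i < n - M keeps the
   second index below n. *)
pose J := pairs (iota 0 (n - M)) (iota 0 M).
pose a (u : nat * nat) := lam u.1.
pose b (u : nat * nat) := lam (u.1 + u.2).+1.
have JP (u : nat * nat) : u \in J -> [/\ u.1 < n - M, u.2 < M & (u.1 + u.2).+1
  < n].
  by rewrite mem_pairs !mem_iota /= !add0n => /andP[h1 h2]; split; lia.
have abJ (u : nat * nat) : u \in J -> (a u < b u)%R.
  by move=> /JP[h1 h2 h3]; apply: lam_lt => //; lia.
have aJ (u : nat * nat) : u \in J -> a u \in s.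
  by move=> /JP[h1 h2 h3]; apply: mem_nth; rewrite nE; lia.
have bJ (u : nat * nat) : u \in J -> b u \in s.
  by move=> /JP[h1 h2 h3]; apply: mem_nth; rewrite nE.
pose near (u v : nat * nat) := (v.1 < u.1 + M) && (u.1 < v.1 + M).
have hoff (u v : nat * nat) : u \in J -> v \in J -> u != v ->
    32 * sg ^ 2 * M * Q (a u) (b u) (a v) (b v) <= near u v * (n * t ^ 4).
  move=> uJ vJ uv; have [u1 u2 u3] := JP _ uJ; have [v1 v2 v3] := JP _ vJ.
  case: (leqP (v.1 + v.2).+1 u.1) => [h|h1].
    rewrite /Q vec_coinc_slopes ?muln0 ?abJ //.
    rewrite /a /b; case: (ltngtP (v.1 + v.2).+1 u.1) h => // [h _|-> _];
      last exact: lexx.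
    by apply/ltW/lam_lt => //; lia.
  case: (leqP (u.1 + u.2).+1 v.1) => [h|h2].
    rewrite /Q vec_coinc_sym vec_coinc_slopes ?muln0 ?abJ //.
    rewrite /a /b; case: (ltngtP (u.1 + u.2).+1 v.1) h => // [h _|-> _];
      last exact: lexx.
    by apply/ltW/lam_lt => //; lia.
  have -> : near u v by rewrite /near; apply/andP; split; lia.
  rewrite mul1n leqNgt; apply/negP => hb.
  (* When M = 1 only consecutive lines are paired, and two such pairs that are near are equal.
     Otherwise the assumed failure applies to these four slopes. *)
  move: hno; rewrite negb_and => /orP[M1|].
    move/negP: uv; apply; apply/eqP;
      case: (u) (v) u1 u2 v1 v2 h1 h2 => [x y] [z w] /=.
    by move=> *; congr (_, _); lia.
  move/hasPn/(_ (a u, b u)); rewrite mem_pairs /= aJ // bJ // => /(_ isT).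
  move/hasPn/(_ (a v, b v)); rewrite mem_pairs /= aJ // bJ // => /(_ isT).
  rewrite !abJ //= /big hb andbT negbK => /eqP[e1 e2].
  have uslam : uniq s by apply: (sorted_uniq lt_trans ltxx).
  move: e1 e2 => /eqP; rewrite nth_uniq ?nE //; try lia.
  move=> /eqP e1 /eqP; rewrite nth_uniq ?nE //; try lia.
  move=> /eqP e2; move/negP: uv; apply; apply/eqP.
  by case: (u) (v) e1 e2 => [x y] [z w] /= -> h; congr (_, _); lia.
have sJ : size J = (n - M) * M by rewrite size_pairs !size_iota.
pose r := quot_rep A.
pose cnt := \sum_(u <- J) r (a u) * r (b u).
pose off := \sum_(u <- J) \sum_(v <- J) (u != v) * Q (a u) (b u) (a v) (b v).
have hcnt : (n - M) * M * t ^ 2 <= cnt.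
  rewrite -sJ -sum_const_seq.
  by apply: leq_sum_seq => u uJ; rewrite -mulnn leq_mul ?hs ?aJ ?bJ.
have hcol : cnt ^ 2 <= sg ^ 2 * (cnt + off).
  pose w (i : (nat * nat) * (R * R)) :=
    ((a i.1 * i.2.1)%R \in A) * ((b i.1 * i.2.2)%R \in A).
  pose f (i : (nat * nat) * (R * R)) :=
    (i.2.1 + i.2.2, a i.1 * i.2.1 + b i.1 * i.2.2)%R.
  have := @collision _ _ (pairs J (pairs A A)) (pairs S S) f w (pairs_uniq uS
    uS) _.
  rewrite size_pairs mulnn.
  have -> : \sum_(i <- pairs J (pairs A A)) w i = cnt.
    by rewrite sum_pairs; apply: eq_bigr => u _;
      exact: (sum_pair_weights A (a u) (b u)).
  move=> h; apply: leq_trans (h _) _.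
    move=> i; rewrite !mem_pairs => /and3P[iJ i1 i2];
      rewrite /w muln_gt0 !lt0b => /andP[h1 h2].
    by rewrite /f /= !hS.
  rewrite leq_mul2l; apply/orP; right.
  rewrite sum_pairs /cnt /off -big_split /=; apply: leq_sum_seq => u uJ.
  apply: (@leq_trans (\sum_(v <- J) Q (a u) (b u) (a v) (b v))).
    rewrite exchange_big sum_pairs /=; apply: leq_sum => v _.
    by rewrite exchange_big.
  have uJ' : uniq J by apply: pairs_uniq; apply: iota_uniq.
  rewrite (bigD1_seq _ uJ uJ') /= leq_add //.
    by apply: vec_coinc_diag => //; rewrite lt_eqF // abJ.
  rewrite big_mkcond /=; apply: leq_sum => v _.
  by rewrite eq_sym; case: (u != v); rewrite ?mul1n.
have hoff2 : 32 * sg ^ 2 * M * off <= (n - M) * M * (2 * M * M) * (n * t ^ 4).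
  rewrite -sJ -[leqRHS]mulnA -[leqRHS]sum_const_seq.
  rewrite /off big_distrr /=; apply: leq_sum_seq => u uJ.
  apply: (@leq_trans (\sum_(v <- J) near u v * (n * t ^ 4))).
    rewrite big_distrr /=; apply: leq_sum_seq => v vJ.
    case: (boolP (u != v)) => uv; last by rewrite mul0n muln0.
    by rewrite mul1n hoff.
  rewrite -big_distrl leq_mul2r /=; apply/orP; right.
  rewrite sum_pairs.
  apply: (@leq_trans (\sum_(i <- iota 0 (n - M)) M * ((i < u.1 + M) && (u.1 < i
    + M)))).
    by apply: leq_sum => i _; rewrite /near /= sum_const_seq size_iota.
  rewrite -big_distrr /= mulnC leq_mul2r; apply/orP; right.
  rewrite -[leqRHS](size_iota (u.1 - M)).
  apply: sum_le_size_subset; first exact: iota_uniq.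
  have hi (i x : nat) : i < x + M -> x < i + M -> i \in iota (x - M) (2 * M).
    by rewrite mem_iota; lia.
  by move=> i _ /andP[]; apply: hi.
move: hcnt hcol hoff2; set k := n - M => hcnt hcol hoff2.
have kn : n <= 2 * k by rewrite /k; lia.
have k0 : 0 < k by rewrite /k; lia.
(* As cnt >= n M t^2 / 2 >= 2 |S|^2, the diagonal part of the collision bound is at most half of
   cnt^2. *)
have h1 : 2 * sg ^ 2 <= cnt.
  apply: leq_trans hcnt.
  rewrite -(leq_pmul2l (isT : 0 < 2)); apply: (@leq_trans (4 * sg ^ 2));
    first by lia.
  by apply: leq_trans hM _; rewrite !mulnA; do 3!apply: leq_mul => //.
have h2 : cnt ^ 2 <= 2 * sg ^ 2 * off.
  have := leq_mul h1 (leqnn cnt); rewrite -mulnn in hcol *.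
  move: hcol; rewrite mulnDr; lia.
(* Each u has at most 2M * M near v. If all their coincidence counts were small, 16 k <= 2 n would
   follow, against n <= 2 k and k > 0. *)
have h3 : 16 * M * (k * M * t ^ 2) ^ 2 <= k * M * (2 * M * M) * (n * t ^ 4).
  apply: leq_trans hoff2; apply: (@leq_trans (16 * M * cnt ^ 2)).
    by rewrite leq_mul2l leq_sqr hcnt orbT.
  have := leq_mul (leqnn (16 * M)) h2; lia.
have h4 : (k * M ^ 3 * t ^ 4) * (16 * k) <= (k * M ^ 3 * t ^ 4) * (2 * n).
  by move: h3; congr (_ <= _); ring.
move: h4; rewrite leq_pmul2l ?muln_gt0 ?expn_gt0 ?k0 ?M0 ?t0 //; lia.
Qed.

(** * Sumsets of sets with small third moments *)

Definition differences (R : realFieldType) (X Y : seq R) : seq R :=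
  undup [seq (x - y)%R | x <- X, y <- Y].

Lemma diff_repE (R : realFieldType) (X Y : seq R) (z : R) :
  uniq X -> diff_rep X Y z = \sum_(x <- X) \sum_(y <- Y) ((x - y)%R == z).
Proof.
move=> uX; rewrite exchange_big /=; apply: eq_bigr => y _.
rewrite -(sum_mem_uniq _ uX); apply: eq_bigr => x _.
by rewrite subr_eq eq_sym.
Qed.

Lemma sum_differences (R : realFieldType) (X Y : seq R) (F : R -> nat) :
  uniq X ->
  \sum_(x <- X) \sum_(y <- Y) F (x - y)%R =
  \sum_(z <- differences X Y) diff_rep X Y z * F z.
Proof.
move=> uX; rewrite -(sum_pairs X Y (fun p => F (p.1 - p.2)%R)).
rewrite (eq_bigr (fun p => 1 * F (p.1 - p.2)%R)); last by move=> p _;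
  rewrite mul1n.
rewrite (sum_fiber (f := fun p => (p.1 - p.2)%R) (fun=> 1) F (undup_uniq _ :
  uniq (differences X Y))).
  apply: eq_bigr => z _; congr (_ * _); rewrite diff_repE // sum_pairs.
  by apply: eq_bigr => x _; apply: eq_bigr => y _; rewrite mul1n.
move=> p; rewrite mem_pairs mem_undup => /andP[h1 h2].
by apply/allpairsP; exists p.
Qed.

(* D + (D cap (D - x)) lies in (D + D) cap (D + D - x) (Katz and Koester);
   P is the set of popular differences x. *)
Lemma schoen_shkredov (R : realFieldType) (D S : seq R) (d : nat) :
  uniq D -> uniq S -> {in D &, forall x y, (x + y)%R \in S} ->
  0 < d -> size D < 2 ^ d ->
  let E3 := \sum_(z <- differences D D) diff_rep D D z ^ 3 in
  let F2 := \sum_(z <- differences D S) diff_rep D S z ^ 2 in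
  exists p rho, [/\ (p * rho * size D) ^ 2 * rho <= F2 * E3,
    size D ^ 4 <= size S * (4 * d * (p * rho ^ 2)) & p * rho ^ 3 <= E3].
Proof.
move=> uD uS hS d0 Dd E3 F2.
pose r := diff_rep D D; pose De := differences D D.
have rd z : r z < 2 ^ d.
  apply: leq_ltn_trans Dd; rewrite -[leqRHS]muln1 -(sum_const_seq D 1).
  by apply: leq_sum => x _; apply: leq_b1.
have [j [_ hj]] := dyadic_class De d0 rd.
pose P := [seq i <- De | 2 ^ j <= r i < 2 ^ j.+1].
rewrite -/P in hj.
have uP : uniq P by rewrite filter_uniq ?undup_uniq.
have PDe : {subset P <= De} by move=> x; rewrite mem_filter => /andP[].
have rP x : x \in P -> 2 ^ j <= r x by rewrite mem_filter => /andP[/andP[]].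
exists (size P), (2 ^ j); split.
(* The map (x, a, c) -> (x, a + c) sends the triples with c and c + x in D into Z, because a + c and
   a + c + x both lie in S. *)
- pose Z := [seq q <- pairs P S | (q.1 + q.2)%R \in S].
  have uZ : uniq Z by rewrite filter_uniq ?pairs_uniq.
  pose w (i : R * (R * R)) := nat_of_bool ((i.2.2 + i.1)%R \in D).
  pose f (i : R * (R * R)) := (i.1, i.2.1 + i.2.2)%R.
  have := @collision _ _ (pairs P (pairs D D)) Z f w uZ _.
  have hw : size P * 2 ^ j * size D <= \sum_(i <- pairs P (pairs D D)) w i.
    rewrite sum_pairs -mulnA -sum_const_seq; apply: leq_sum_seq => x xP.
    rewrite sum_pairs /w /= sum_const_seq mulnC leq_mul2l.
    apply/orP; right; apply: leq_trans (rP x xP) _.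
    by apply: leq_sum => c _; rewrite addrC.
  (* A collision means a' - a = c - c'. For fixed c and c' there are r (c - c') pairs (a, a'), and
     at most as many x since (c + x) - (c' + x) = c - c'. The sum of r (c - c')^2 over c, c' is the
     third moment. *)
  have hcol : \sum_(i <- pairs P (pairs D D)) \sum_(k <- pairs P (pairs D D))
      w i * w k * (f i == f k) <= E3.
    apply: (@leq_trans (\sum_(c <- D) \sum_(c' <- D)
       (\sum_(a <- D) \sum_(a' <- D) ((a' - a)%R == (c - c')%R)) *
       (\sum_(x <- P) ((c + x)%R \in D) * ((c' + x)%R \in D)))); last first.
      rewrite [leqRHS](eq_bigr (fun z => r z * r z ^ 2)); last by move=> z _;
        exact: expnS.
      rewrite -(sum_differences _ (fun z => r z ^ 2) uD).
      apply: leq_sum => c _; apply: leq_sum => c' _.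
      rewrite -mulnn leq_mul //.
        by rewrite exchange_big -diff_repE.
      apply: (@leq_trans (\sum_(x <- P) \sum_(v <- D) ((c' + x)%R == v) * ((c -
        c' + v)%R \in D))).
        apply: leq_sum => x _; case: (boolP ((c' + x)%R \in D)) => h;
          last by rewrite muln0.
        rewrite (bigD1_seq _ h uD) /= eqxx mul1n muln1.
        have -> : (c - c' + (c' + x) = c + x)%R by ring.
        exact: leq_addr.
      rewrite exchange_big /=; apply: leq_sum => v _.
      rewrite -big_distrl /= -[leqRHS]mul1n leq_mul2r; apply/orP; right.
      by apply: sum_eq_le1 => // x y _ _ /eqP <- /eqP /addrI.
    rewrite sum_pairs.
    apply: (@leq_trans (\sum_(x <- P) \sum_(a <- D) \sum_(c <- D) \sum_(a' <-
      D) \sum_(c' <- D)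
        ((a' - a)%R == (c - c')%R) * (((c + x)%R \in D) * ((c' + x)%R \in D)))).
      apply: leq_sum_seq => x xP; rewrite sum_pairs; apply: leq_sum => a _;
        apply: leq_sum => c _.
      rewrite sum_pairs (bigD1_seq _ xP uP) /= [X in _ + X]big1 ?addn0;
        last first.
        move=> y /negPf yx; rewrite big1 // => q _.
        by rewrite /f xpair_eqE /= eq_sym yx muln0.
      rewrite sum_pairs; apply: leq_sum => a' _; apply: leq_sum => c' _.
      rewrite /f /w /=; case: eqP => [[e]|]; last by rewrite muln0.
      rewrite (_ : (a' - a == c - c')%R) ?mul1n ?muln1 //.
      by apply/eqP; move: e; lra.
    apply: eq_leq.
    transitivity (\sum_(c <- D) \sum_(c' <- D) \sum_(a <- D) \sum_(a' <- D)
      \sum_(x <- P)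
       ((a' - a)%R == (c - c')%R) * (((c + x)%R \in D) * ((c' + x)%R \in D))).
      rewrite exchange_big /=.
      transitivity (\sum_(a <- D) \sum_(c <- D) \sum_(x <- P) \sum_(a' <- D)
        \sum_(c' <- D)
       ((a' - a)%R == (c - c')%R) * (((c + x)%R \in D) * ((c' + x)%R \in D))).
        by apply: eq_bigr => a _; rewrite exchange_big.
      rewrite exchange_big /=; apply: eq_bigr => c _.
      rewrite [RHS]exchange_big /=; apply: eq_bigr => a _.
      rewrite exchange_big [RHS]exchange_big /=; apply: eq_bigr => a' _.
      by rewrite exchange_big.
    apply: eq_bigr => c _; apply: eq_bigr => c' _.
    rewrite big_distrl /=; apply: eq_bigr => a _.
    rewrite big_distrl /=; apply: eq_bigr => a' _.
    by rewrite big_distrr.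
  (* F2 counts the solutions of c - y' = c' - y. Rearranged as c - c' = y' - y, they are counted by
     the products of the representation functions of D - D and S - S, the former being at least 2^j
     on P. *)
  have hZ : size Z * 2 ^ j <= F2.
    have -> : F2 = \sum_(x <- De) r x * diff_rep S S x.
      rewrite -(sum_differences _ (diff_rep S S) uD).
      rewrite /F2 (eq_bigr (fun z => diff_rep D S z * diff_rep D S z));
        last by move=> z _; rewrite mulnn.
      rewrite -(sum_differences _ (diff_rep D S) uD) exchange_big
        [RHS]exchange_big /=.
      transitivity (\sum_(y <- S) \sum_(c' <- D) \sum_(c <- D) \sum_(y' <- S)
        ((c - y')%R == (c' - y)%R)).
        by apply: eq_bigr => y _; apply: eq_bigr => c' _; rewrite diff_repE.
      rewrite exchange_big /=; apply: eq_bigr => c' _.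
      rewrite exchange_big /=; apply: eq_bigr => c _.
      rewrite diff_repE // [RHS]exchange_big /=; apply: eq_bigr => y _;
        apply: eq_bigr => y' _.
      by congr nat_of_bool; apply/eqP/eqP; lra.
    have -> : size Z = \sum_(x <- P) diff_rep S S x.
      rewrite size_filter -sum1_count big_mkcond sum_pairs /=.
      by apply: eq_bigr => x _; apply: eq_bigr => y _; case: ifP.
    rewrite big_distrl /=.
    apply: leq_trans (leq_sum_subset _ uP PDe).
    by apply: leq_sum_seq => x xP; rewrite mulnC leq_mul ?rP.
  move=> h; have {}h := h _.
  apply: (@leq_trans ((size Z * 2 ^ j) * E3)); last by rewrite leq_mul2r hZ orbT.
  rewrite [leqRHS]mulnAC leq_mul2r; apply/orP; right.
  apply: leq_trans (_ : (\sum_(i <- pairs P (pairs D D)) w i) ^ 2 <= _);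
    first by rewrite leq_sqr.
  apply: leq_trans (h _) _; last by rewrite leq_mul2l hcol orbT.
  move=> i; rewrite !mem_pairs => /and3P[i1 i2 i3]; rewrite lt0b => h1.
  have e : (i.1 + (i.2.1 + i.2.2) = i.2.1 + (i.2.2 + i.1))%R by ring.
  by rewrite mem_filter mem_pairs /f /= i1 e !hS.
(* Cauchy--Schwarz for D + D: the coincidences a + b = a' + b' form the additive energy, which is
   the second moment of [r]. *)
- apply: leq_trans (_ : size S * \sum_(i <- De) r i ^ 2 <= _);
  last by rewrite leq_mul2l hj orbT.
  have := @collision _ _ (pairs D D) S (fun p => p.1 + p.2)%R (fun=> 1) uS _.
  rewrite sum_const_seq muln1 size_pairs mulnn -expnM => h.
  apply: leq_trans (h _) _.
    by move=> p; rewrite mem_pairs => /andP[h1 h2] _; apply: hS.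
  rewrite leq_mul2l; apply/orP; right; apply: eq_leq.
  rewrite [RHS](eq_bigr (fun z => r z * r z)); last by move=> z _; rewrite mulnn.
  rewrite -(sum_differences _ r uD) sum_pairs.
  transitivity (\sum_(a <- D) \sum_(b <- D) \sum_(a' <- D) \sum_(b' <- D) ((b'
    - b)%R == (a - a')%R)).
    apply: eq_bigr => a _; apply: eq_bigr => b _; rewrite sum_pairs.
    apply: eq_bigr => a' _; apply: eq_bigr => b' _; rewrite /= mul1n mul1n.
    by congr nat_of_bool; apply/eqP/eqP; lra.
  apply: eq_bigr => a _; rewrite exchange_big /=; apply: eq_bigr => a' _.
  by rewrite /r diff_repE // exchange_big.
- rewrite -sum_const_seq;
  apply: leq_trans (leq_sum_subset (fun z => r z ^ 3) uP PDe).
  by apply: leq_sum_seq => x xP; rewrite leq_exp2r // rP.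
Qed.

Lemma sum_diff_rep (R : realFieldType) (X Y : seq R) :
  uniq X -> \sum_(z <- differences X Y) diff_rep X Y z = size X * size Y.
Proof.
move=> uX; rewrite (eq_bigr (fun z => diff_rep X Y z * 1));
  last by move=> z _; rewrite muln1.
by rewrite -(sum_differences _ (fun=> 1) uX) -(sum_pairs X Y (fun=> 1))
  sum_const_seq muln1 size_pairs.
Qed.

(** * The estimates for sets of positive numbers *)

Definition fib (R : realFieldType) (A : seq R) (l : R) : seq R :=
  [seq x <- A | (l * x)%R \in A].

Definition sums (R : realFieldType) (A : seq R) : seq R :=
  undup [seq (x + y)%R | x <- A, y <- A].

Definition prods (R : realFieldType) (A B : seq R) : seq R :=
  undup [seq (x * y)%R | x <- A, y <- B].

Lemma size_fib (R : realFieldType) (A : seq R) (l : R) :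
  size (fib A l) = quot_rep A l.
Proof. by rewrite size_filter -sum1_count big_mkcond; apply: eq_bigr => x _;
  case: ifP. Qed.

Lemma mem_sums (R : realFieldType) (A : seq R) :
  {in A &, forall x y, (x + y)%R \in sums A}.
Proof. by move=> x y xA yA; rewrite mem_undup; apply/allpairsP;
  exists (x, y). Qed.

Lemma mem_prods (R : realFieldType) (A B : seq R) :
  {in A & B, forall x y, (x * y)%R \in prods A B}.
Proof. by move=> x y xA yB; rewrite mem_undup; apply/allpairsP;
  exists (x, y). Qed.

Lemma prodsP (R : realFieldType) (A B : seq R) (z : R) :
  z \in prods A B -> exists x y, [/\ x \in A, y \in B & z = (x * y)%R].
Proof. by rewrite mem_undup => /allpairsP[[x y] /= [? ? ->]]; exists x, y. Qed.

Lemma quot_rep_le (R : realFieldType) (A : seq R) (l : R) : quot_rep A l <=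
  size A.
Proof. by rewrite -size_fib size_filter count_size. Qed.

Lemma size_sums (R : realFieldType) (A : seq R) :
  uniq A -> size A <= size (sums A).
Proof.
case: A => [//|a A] uA; rewrite -(size_map (+%R a)); apply: uniq_leq_size.
  by rewrite map_inj_uniq //; apply: addrI.
by move=> z /mapP[x xA ->]; apply: mem_sums; rewrite ?mem_head.
Qed.

(** Cauchy--Schwarz for the products of pairs; a coincidence a b = a' b' is rewritten as (a / a') b
    = b'. *)
Lemma energy_lower (R : realFieldType) (A : seq R) :
  uniq A -> {in A, forall x, (0 < x)%R} ->
  size A ^ 4 <= size (prods A A) * mul_energy A.
Proof.
move=> uA A0.
have := @collision _ _ (pairs A A) (prods A A) (fun p => p.1 * p.2)%R (fun=> 1)
  (undup_uniq _) _.
rewrite sum_const_seq muln1 size_pairs mulnn -expnM => h.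
apply: leq_trans (h _) _.
  by move=> p; rewrite mem_pairs => /andP[h1 h2] _; apply: mem_prods.
rewrite leq_mul2l; apply/orP; right; apply: eq_leq.
have -> : mul_energy A = \sum_(p <- pairs A A) quot_rep A (p.1 / p.2)%R.
  rewrite [RHS](eq_bigr (fun p => 1 * quot_rep A (p.1 / p.2)%R));
    last by move=> p _; rewrite mul1n.
  rewrite (sum_fiber (f := fun p => (p.1 / p.2)%R) (fun=> 1) _ (undup_uniq _ :
    uniq (quotients A))).
    apply: eq_big_seq => z _; rewrite -mulnn; congr (_ * _).
    rewrite sum_pairs exchange_big /=; apply: eq_big_seq => y yA.
    rewrite -(sum_mem_uniq _ uA); apply: eq_bigr => x _.
    have y0 : y != 0%R by rewrite gt_eqF // A0.
    rewrite mul1n; congr nat_of_bool; apply/eqP/eqP => [<-|<-];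
      first by rewrite mulfK.
    by rewrite divfK.
  by move=> p; rewrite mem_pairs => /andP[]; apply: quotient_mem.
transitivity (\sum_(a <- A) \sum_(b <- A) \sum_(a' <- A) \sum_(b' <- A) (a * b
  == a' * b')%R).
  rewrite sum_pairs; apply: eq_bigr => a _; apply: eq_bigr => b _.
  by rewrite sum_pairs; apply: eq_bigr => a' _; apply: eq_bigr => b' _;
    rewrite mul1n mul1n.
rewrite sum_pairs; apply: eq_bigr => a _; rewrite exchange_big /=;
  apply: eq_big_seq => a' a'A.
apply: eq_bigr => b _; rewrite -(sum_mem_uniq _ uA); apply: eq_bigr => b' _.
have a'0 : a' != 0%R by rewrite gt_eqF // A0.
congr nat_of_bool; apply/eqP/eqP => [e|<-]; last by field.
by apply: (mulfI a'0); rewrite -e; field.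
Qed.

Lemma vec_coinc_swap (R : realFieldType) (A : seq R) (l1 l2 l3 l4 : R) :
  vec_coinc A l1 l2 l3 l4 = vec_coinc A l2 l1 l3 l4.
Proof.
rewrite /vec_coinc !sum_pairs exchange_big /=; apply: eq_bigr => x _.
apply: eq_bigr => y _; apply: eq_bigr => q _.
rewrite /= [X in X * _ * _]mulnC.
by congr (_ * nat_of_bool (_ == _)); congr (_, _); apply: addrC.
Qed.

(* Eliminating the point on the line of slope l1. *)
Lemma vec_coinc_elim (R : realFieldType) (A : seq R) (l1 l2 l3 l4 : R) :
  uniq A -> l1 != l2 ->
  vec_coinc A l1 l2 l3 l4 <=
  \sum_(q <- pairs (fib A l3) (fib A l4))
    (((l3 - l1) / (l2 - l1) * q.1 + (l4 - l1) / (l2 - l1) * q.2)%R \in fib A l2).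
Proof.
move=> uA l12.
have l21 : (l2 - l1 != 0)%R by rewrite subr_eq0 eq_sym.
pose F (q : R * R) := nat_of_bool
  (((l3 - l1) / (l2 - l1) * q.1 + (l4 - l1) / (l2 - l1) * q.2)%R \in fib A l2).
have -> : \sum_(q <- pairs (fib A l3) (fib A l4)) F q =
  \sum_(q <- pairs A A) ((l3 * q.1)%R \in A) * ((l4 * q.2)%R \in A) * F q.
  rewrite !sum_pairs big_filter big_mkcond; apply: eq_bigr => x _.
  case: ifP => h; last by rewrite big1.
  rewrite big_filter big_mkcond; apply: eq_bigr => y _.
  by case: ifP; rewrite /= ?h ?mul1n.
rewrite /vec_coinc exchange_big /=; apply: leq_sum => q _.
case: (_ \in A); last by rewrite big1 // => p _; rewrite !mul0n muln0.
case: (_ \in A); last by rewrite big1 // => p _; rewrite !muln0.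
rewrite !muln1 mul1n.
pose sol (p : R * R) := [&& (l1 * p.1)%R \in A, (l2 * p.2)%R \in A &
   ((p.1 + p.2, l1 * p.1 + l2 * p.2) == (q.1 + q.2, l3 * q.1 + l4 * q.2))%R].
rewrite (eq_bigr (fun p => nat_of_bool (sol p))); last first.
  by move=> p _; rewrite /sol; case: (_ \in A); case: (_ \in A); case: (_ == _).
(* Subtracting l1 times the first coordinate from the second removes p.1. Then p.2 is determined by
   q, and p.1 by the first coordinate. *)
have sol2 p : sol p -> p.2 = ((l3 - l1) / (l2 - l1) * q.1 + (l4 - l1) / (l2 -
  l1) * q.2)%R.
  move=> /and3P[_ _ /eqP[e1 e2]]; apply: (mulfI l21).
  have e3 : (l1 * (p.1 + p.2) = l1 * (q.1 + q.2))%R by rewrite e1.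
  have -> : ((l2 - l1) * ((l3 - l1) / (l2 - l1) * q.1 + (l4 - l1) / (l2 - l1) *
    q.2) =
             (l3 - l1) * q.1 + (l4 - l1) * q.2)%R by field.
  lra.
case: (boolP (has sol (pairs A A))) => [/hasP[p pA solp]|/hasPn no]; last first.
  by rewrite big_seq big1 // => p /no /negPf ->.
have -> : F q = true.
  rewrite /F -(sol2 p solp) mem_filter; move: solp => /and3P[_ -> _].
  by move: pA; rewrite mem_pairs => /andP[_ ->].
apply: sum_eq_le1; first exact: pairs_uniq.
move=> u v _ _ su sv; have := sol2 u su; rewrite -(sol2 v sv) => e.
move: su sv => /and3P[_ _ /eqP[e1 _]] /and3P[_ _ /eqP[e2 _]].
move: e1; rewrite -e2 e => /addIr.
by case: (u) (v) e => [? ?] [? ?] /= -> ->.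
Qed.

(** Eliminating l1 leaves nonzero coefficients only if l1 differs from l3 and l4. If it equals one
    of them, the order of the slopes and the distinctness of the pairs make l2 differ from both, and
    l2 is eliminated instead. The slope [l] is the one that remains. *)
Lemma vec_coinc_bound (R : realFieldType) (A : seq R) (l1 l2 l3 l4 : R) (t d :
  nat) :
  uniq A -> {in A, forall x, (0 < x)%R} -> 0 < d -> size A < 2 ^ d ->
  {in [:: l1; l2; l3; l4], forall l, t <= quot_rep A l <= 2 * t} ->
  (l1 < l2)%R -> (l3 < l4)%R -> (l1, l2) != (l3, l4) ->
  exists2 l, l \in [:: l1; l2] &
    (size A * vec_coinc A l1 l2 l3 l4) ^ 4 <=
    size (prods A (fib A l)) ^ 2 * (64 * 129 * d * mul_energy A * t ^ 6).
Proof.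
move=> uA A0 d0 Ad ht.
have key m1 m2 : {in [:: m1; m2; l3; l4], forall l, t <= quot_rep A l <= 2 * t} ->
    m1 != m2 -> m1 != l3 -> m1 != l4 ->
    (size A * vec_coinc A m1 m2 l3 l4) ^ 4 <=
    size (prods A (fib A m2)) ^ 2 * (64 * 129 * d * mul_energy A * t ^ 6).
  move=> h m12 m13 m14.
  have sub0 m : m1 != m -> (m - m1 != 0)%R by rewrite subr_eq0 eq_sym.
  have [h2 h3 h4] : [/\ t <= quot_rep A m2 <= 2 * t, t <= quot_rep A l3 <= 2 * t &
      t <= quot_rep A l4 <= 2 * t].
    by split; apply: h; rewrite !inE eqxx ?orbT.
  have uf l : uniq (fib A l) by rewrite filter_uniq.
  have fd l : size (fib A l) < 2 ^ d.
    by rewrite size_fib; apply: leq_ltn_trans (quot_rep_le _ _) Ad.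
  move: h2 h3 h4 => /andP[_ h2] /andP[h3 h3'] /andP[h4 h4'].
  have := @few_sums_many_products _ A (fib A m2) (fib A l3) (fib A l4) (prods A
    (fib A m2))
    ((l3 - m1) / (m2 - m1))%R ((l4 - m1) / (m2 - m1))%R t d uA (uf _) (uf _)
      (undup_uniq _) A0 _ _ _ _ d0.
  rewrite !size_fib => H.
  apply: leq_trans; last apply: H => //.
  - by rewrite leq_exp2r // leq_mul2l vec_coinc_elim ?orbT.
  - by move=> x; rewrite mem_filter => /andP[].
  - exact: mem_prods.
  - by rewrite mulf_neq0 ?invr_eq0 ?sub0.
  - by rewrite mulf_neq0 ?invr_eq0 ?sub0.
  - by rewrite -size_fib.
  - by rewrite -size_fib.
move=> l12 l34 ne.
have [/andP[h13 h14]|h1] := boolP ((l1 != l3) && (l1 != l4)).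
  exists l2; first by rewrite !inE eqxx orbT.
  by apply: key; rewrite // lt_eqF.
exists l1; first by rewrite !inE eqxx.
rewrite vec_coinc_swap; apply: key.
- by move=> l hl; apply: ht; move: hl; rewrite !inE => /or4P[] ->; rewrite ?orbT.
- by rewrite gt_eqF.
- move: h1; rewrite negb_and !negbK => /orP[/eqP e|/eqP e].
    by rewrite -e gt_eqF.
  by rewrite gt_eqF // (lt_trans l34) // -e.
- move: h1; rewrite negb_and !negbK => /orP[/eqP e|/eqP e].
    by apply: contraNneq ne => e'; rewrite e e'.
  by rewrite -e gt_eqF.
Qed.

(** The window is the least allowed by [many_coincidences], of order |A + A|^2 / (n t^2). Either it
    does not fit among the n lines, which is the first alternative, or the coincidences found are
    fed into [vec_coinc_bound]. *)
Lemma slope_with_many_products (R : realFieldType) (A s : seq R) (t d K : nat) :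
  256 ^ 4 * (64 * 129) <= K ->
  uniq A -> {in A, forall x, (0 < x)%R} -> 0 < d -> size A < 2 ^ d ->
  uniq s -> {in s, forall l, t <= quot_rep A l <= 2 * t} -> 0 < t ->
  0 < size s ->
  size s ^ 2 * t ^ 2 <= 12 * size (sums A) ^ 2 \/
  exists2 l, l \in s &
    size A ^ 4 * size s ^ 8 * t ^ 18 <=
    K * d * size (sums A) ^ 16 * mul_energy A *
      size (prods A (fib A l)) ^ 2.
Proof.
move=> hK uA A0 d0 Ad us hs t0 n0.
pose s' := sort <=%R s.
have s's : s' =i s by apply: mem_sort.
have size_s' : size s' = size s by rewrite size_sort.
have ss' : sorted <%R%R s' by rewrite sort_lt_sorted.
have [l0 l0s] : exists l, l \in s.
  by case: (s) n0 => // l ? _; exists l; apply: mem_head.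
set n := size s in n0 *; set sg := size (sums A).
have nt0 : 0 < n * t ^ 2 by rewrite muln_gt0 n0 expn_gt0 t0.
have sg0 : t <= sg.
  have /andP[h _] := hs l0 l0s.
  by apply: leq_trans h _; apply: leq_trans (quot_rep_le _ _) (size_sums uA).
pose m := (4 * sg ^ 2) %/ (n * t ^ 2).
have hm1 : m * (n * t ^ 2) <= 4 * sg ^ 2 by apply: leq_divM.
have hm2 : 4 * sg ^ 2 <= m.+1 * (n * t ^ 2) by apply/ltnW/ltn_ceil.
clearbody m.
(* If the window m + 1 is too wide, then n <= 2m + 1, which is at most 3m unless m = 0, and 12 = 3 *
   4; for m = 0 there is a single line and t <= |A + A|. *)
case: (leqP (2 * m.+1) n) => hmn; last first.
  left; case: (posnP m) => [m0|m0].
    have -> : n = 1 by lia.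
    by rewrite mul1n; apply: leq_trans (leq_pmull _ _); rewrite // leq_sqr.
  have h : n * (n * t ^ 2) <= (3 * m) * (n * t ^ 2) by rewrite leq_mul2r;
    apply/orP; right; lia.
  have -> : n ^ 2 * t ^ 2 = n * (n * t ^ 2) by ring.
  apply: leq_trans h _; rewrite -mulnA.
  apply: leq_trans (_ : 3 * (4 * sg ^ 2) <= _).
    by rewrite leq_mul2l hm1 orbT.
  by rewrite mulnA.
right.
have hs' : {in s', forall l, t <= quot_rep A l} by move=> l;
  rewrite s's => /hs/andP[].
have := @many_coincidences _ A (sums A) s' t m.+1 uA (undup_uniq _) A0
  (@mem_sums _ A) ss' hs' t0 isT.
rewrite size_s' -/n -/sg => H.
have {H}[|m0 [l1 [l2 [l3 [l4 [[h1 h2 h3 h4] l12 l34 ne hQ]]]]]] := H hmn.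
  by rewrite mulnAC [leqRHS]mulnC.
rewrite s's in h1; rewrite s's in h2; rewrite s's in h3; rewrite s's in h4.
have h1234 : {in [:: l1; l2; l3; l4], forall l, t <= quot_rep A l <= 2 * t}.
  by move=> l; rewrite !inE => /or4P[] /eqP ->; apply: hs.
have [l ll hl] := vec_coinc_bound uA A0 d0 Ad h1234 l12 l34 ne.
exists l; first by move: ll; rewrite !inE => /orP[] /eqP ->.
move: hl hQ; set Q := vec_coinc _ _ _ _ _; set T := size (prods _ _);
  set E := mul_energy A.
set N := size A; move=> hl hQ.
have hQ2 : n ^ 2 * t ^ 6 <= 256 * sg ^ 4 * Q.
  have -> : n ^ 2 * t ^ 6 = (n * t ^ 2) * (n * t ^ 4) by ring.
  apply: leq_trans (leq_mul (leqnn _) (ltnW hQ)) _.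
  (* The conclusion 1 < M of [many_coincidences] gives m >= 1, so rounding up at most doubles m;
     then 256 = 8 * 32. *)
  have : m.+1 * (n * t ^ 2) <= 8 * sg ^ 2.
    have : 1 * (n * t ^ 2) <= m * (n * t ^ 2) by rewrite leq_mul2r; apply/orP;
      right.
    by clear -hm1; rewrite mul1n mulSn => h; lia.
  move=> h; have := leq_mul h (leqnn (32 * sg ^ 2 * Q)).
  by congr (_ <= _); ring.
rewrite -(leq_pmul2r (_ : 0 < t ^ 6)) ?expn_gt0 ?t0 //.
have -> : N ^ 4 * n ^ 8 * t ^ 18 * t ^ 6 = N ^ 4 * (n ^ 2 * t ^ 6) ^ 4 by ring.
apply: leq_trans (_ : N ^ 4 * (256 * sg ^ 4 * Q) ^ 4 <= _).
  by rewrite leq_mul2l leq_exp2r ?hQ2 ?orbT.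
have e1 x : N ^ 4 * (x * sg ^ 4 * Q) ^ 4 = x ^ 4 * sg ^ 16 * (N * Q) ^ 4 by ring.
rewrite e1; apply: leq_trans (leq_mul (leqnn _) hl) _.
have e2 x y : x * sg ^ 16 * (T ^ 2 * (y * d * E * t ^ 6)) =
  x * y * d * sg ^ 16 * E * T ^ 2 * t ^ 6 by ring.
rewrite e2; do 5!(rewrite leq_mul2r; apply/orP; right).
exact: hK.
Qed.

Lemma ex_min_seq (I : eqType) (s : seq I) (f : I -> nat) :
  0 < size s -> exists2 x, x \in s & {in s, forall y, f x <= f y}.
Proof.
elim: s => [//|a [|b s] IH] _.
  by exists a => [|y]; rewrite inE // => /eqP ->.
have [x xs hx] := IH isT.
case: (leqP (f a) (f x)) => h.
  exists a; first exact: mem_head.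
  by move=> y; rewrite inE => /predU1P[->//|/hx]; apply: leq_trans.
exists x; first by rewrite inE xs orbT.
by move=> y; rewrite inE => /predU1P[->|/hx //]; apply: ltnW.
Qed.

Lemma ex_large_term (I : eqType) (s : seq I) (f : I -> nat) :
  0 < size s -> exists2 x, x \in s & \sum_(y <- s) f y <= size s * f x.
Proof.
move=> s0; have [x xs hx] : exists2 x, x \in s & {in s, forall y, f y <= f x}.
  elim: s s0 => [//|a [|b s] IH] _.
    by exists a => [|y]; rewrite inE // => /eqP ->.
  have [x xs hx] := IH isT.
  case: (leqP (f x) (f a)) => h.
    exists a; first exact: mem_head.
    by move=> y; rewrite inE => /predU1P[->//|/hx h']; apply: leq_trans h' h.
  exists x; first by rewrite inE xs orbT.
  by move=> y; rewrite inE => /predU1P[->|/hx //]; apply: ltnW.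
by exists x => //; rewrite -sum_const_seq; apply: leq_sum_seq.
Qed.

Lemma size_prods (R : realFieldType) (A : seq R) :
  uniq A -> {in A, forall x, (0 < x)%R} -> size A <= size (prods A A).
Proof.
case: A => [//|a A] uA A0; have a0 := A0 a (mem_head _ _).
rewrite -(size_map ( *%R a)); apply: uniq_leq_size.
  by rewrite map_inj_uniq //; apply: mulfI; rewrite gt_eqF.
by move=> z /mapP[x xA ->]; apply: mem_prods; rewrite ?mem_head.
Qed.

(* The Katz--Koester inclusion of A A_l in AA cap l^-1 AA. *)
Lemma prods_fib_quot_rep (R : realFieldType) (A : seq R) (l : R) :
  size (prods A (fib A l)) <= quot_rep (prods A A) l.
Proof.
rewrite -size_fib; apply: uniq_leq_size; first exact: undup_uniq.
move=> z /prodsP[x [y [xA]]]; rewrite !mem_filter => /andP[lyA yA] ->.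
by rewrite mulrCA !mem_prods.
Qed.

Lemma size_prods_le (R : realFieldType) (A B : seq R) :
  size (prods A B) <= size A * size B.
Proof. by apply: leq_trans (size_undup _) _; rewrite size_allpairs. Qed.

Lemma size_differences (R : realFieldType) (X Y : seq R) :
  size (differences X Y) <= size X * size Y.
Proof. by apply: leq_trans (size_undup _) _; rewrite size_allpairs. Qed.

(** By the Katz--Koester inclusion each l in D is a quotient of elements of AA in at least T ways,
    so [sum_diff_rep_cube] applies to AA and its inverses. There are fewer than 2^(2d) inverses,
    whence 256 d; one more d absorbs the term counting lines. *)
Lemma third_moment (R : realFieldType) (A D C : seq R) (T d : nat) :
  uniq A -> {in A, forall x, (0 < x)%R} -> 0 < d -> size A < 2 ^ d ->
  uniq C -> {in D, forall l, T <= size (prods A (fib A l))} ->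
  0 < size A -> size D <= size C ->
  T ^ 3 * \sum_(z <- differences D C) diff_rep D C z ^ 3 <=
  257 * d * size (prods A A) ^ 4 * size C ^ 2.
Proof.
move=> uA A0 d0 Ad uC hT N0 DC.
have Pgt : 0 < size (prods A A).
  by apply: leq_trans N0 (size_prods uA A0).
pose P := prods A A; pose W := [seq (x^-1)%R | x <- P].
have P0 : {in P, forall x, (0 < x)%R}.
  by move=> z /prodsP[x [y [/A0 x0 /A0 y0 ->]]]; apply: mulr_gt0.
have uW : uniq W by rewrite map_inj_uniq ?undup_uniq //; apply: invr_inj.
have Wd : size W < 2 ^ (2 * d).
  rewrite size_map; apply: leq_ltn_trans (size_prods_le _ _) _.
  by rewrite mulnC expnM mulnn ltn_exp2r.
have hrep : {in D, forall x, T <= \sum_(p <- P) \sum_(w <- W) ((p * w)%R == x)}.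
  move=> x xD; apply: leq_trans (hT x xD) _.
  apply: leq_trans (prods_fib_quot_rep _ _) _.
  rewrite exchange_big big_map /=; apply: leq_sum_seq => q qP.
  rewrite -(sum_mem_uniq _ (undup_uniq _)); apply: leq_sum => p _.
  case: eqP => // <-; rewrite mulfK ?eqxx //.
  by rewrite gt_eqF // P0.
have := sum_diff_rep_cube uC uW (undup_uniq _ : uniq P) (undup_uniq _ : uniq
  (differences D C)) P0 hrep Wd.
rewrite size_map -/P; move=> h; apply: leq_trans h _.
have hZ : size (differences D C) <= size P * size C ^ 2.
  apply: leq_trans (size_differences _ _) _.
  by apply: leq_trans (leq_pmull _ Pgt); rewrite -mulnn leq_mul2r DC orbT.
have := leq_mul (leqnn (size P ^ 3)) hZ.
rewrite -/P; move: (size P) (size C) (size (differences D C)) => p c z h.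
have -> : 257 * d * p ^ 4 * c ^ 2 = d * (p ^ 4 * c ^ 2) + 256 * d * p ^ 4 * c ^
  2 by ring.
have -> : p ^ 2 * (p * z + 128 * (2 * d) * (p * c) ^ 2) = p ^ 3 * z + 256 * d *
  p ^ 4 * c ^ 2 by ring.
rewrite leq_add2r; apply: leq_trans h _; apply: leq_trans (leq_pmull _ d0).
by rewrite mulnA -expnSr.
Qed.

(* Here tau is the dyadic size of the popular fibres A_l, c the number of their
   slopes l, T a lower bound for |A A_l| over the good half of these slopes,
   and n the number of good slopes l with l a in A, for a suitable a. *)
Lemma sum_product_estimates (R : realFieldType) (A : seq R) (d K : nat) :
  256 ^ 4 * (64 * 129) <= K ->
  uniq A -> {in A, forall x, (0 < x)%R} -> 0 < size A -> 0 < d ->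
  size A < 2 ^ d ->
  let N := size A in let S := size (sums A) in let P := size (prods A A) in
  let E := mul_energy A in
  N ^ 3 <= 32 * d * P * S \/
  exists c tau T n p rho F2 E3 F3, [/\
    [/\ N ^ 4 <= P * E, E <= 4 * d * (c * tau ^ 2), T <= P,
        N ^ 4 * c ^ 8 * tau ^ 18 <= 256 * K * d * S ^ 16 * E * T ^ 2 &
        c * tau <= 2 * N * n],
    [/\ (p * rho * n) ^ 2 * rho <= F2 * E3, F2 ^ 2 <= n * S * F3,
        n ^ 4 <= S * (4 * d * (p * rho ^ 2)) & p * rho ^ 3 <= E3] &
    T ^ 3 * E3 <= 257 * d * P ^ 4 * n ^ 2 /\
    T ^ 3 * F3 <= 257 * d * P ^ 4 * S ^ 2].
Proof.
move=> hK uA A0 N0 d0 Ad N S P E.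
have rd z : quot_rep A z < 2 ^ d by apply: leq_ltn_trans (quot_rep_le _ _) Ad.
have [j [_ hj]] := dyadic_class (quotients A) d0 rd.
move: hj; set s0 := filter _ _; set t := 2 ^ j; rewrite -/E => hE.
have hN : N ^ 4 <= P * E by apply: energy_lower.
have t0 : 0 < t by rewrite expn_gt0.
have us0 : uniq s0 by rewrite filter_uniq ?undup_uniq.
have hs0 : {in s0, forall l, t <= quot_rep A l <= 2 * t}.
  move=> l; rewrite mem_filter => /andP[/andP[-> h] _] /=.
  by rewrite -expnS ltnW.
set c := size s0 in hE *.
have E0 : 0 < E by have := expn_gt0 N 4; rewrite N0 => h;
  have := leq_trans h hN; rewrite muln_gt0 => /andP[].
have c0 : 0 < c by have := leq_trans E0 hE; rewrite !muln_gt0 => /andP[_ /andP[]].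
(* The 256 = 2^8 pays for replacing the number of bad slopes by c when these are at least half of
   all. In that case [slope_with_many_products] on the bad slopes either returns a good one, a
   contradiction, or yields the first estimate. *)
pose good l := N ^ 4 * c ^ 8 * t ^ 18 <= 256 * K * d * S ^ 16 * E * size (prods
  A (fib A l)) ^ 2.
pose sg := filter good s0; pose sb := filter (predC good) s0.
have hc : size sg + size sb = c by rewrite !size_filter count_predC.
case: (ltnP (2 * size sg) c) => hsg.
  have sb0 : 0 < size sb by lia.
  have hsb : {in sb, forall l, t <= quot_rep A l <= 2 * t}.
    by move=> l; rewrite mem_filter => /andP[_ /hs0].
  have [h|[l lsb hl]] := slope_with_many_products hK uA A0 d0 Ad (filter_uniq _
    us0) hsb t0 sb0.
    left; rewrite -/S in h.
    have h1 : size sb * t <= 4 * S.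
      rewrite -leq_sqr !expnMn; apply: leq_trans h _.
      by rewrite leq_mul2r orbT.
    have tN : t <= N.
      case: (sb) sb0 hsb => // l ? _ hs; have /andP[h' _] := hs l (mem_head _ _).
      exact: leq_trans h' (quot_rep_le _ _).
    have h2 : c * t <= 8 * S.
      apply: leq_trans (_ : 2 * (size sb * t) <= _);
        last by rewrite -[8]/(2 * 4) -mulnA leq_mul2l.
      by rewrite mulnA leq_mul2r; apply/orP; right; lia.
    rewrite -(leq_pmul2r N0) -expnSr; apply: leq_trans hN _.
    apply: leq_trans (leq_mul (leqnn P) hE) _.
    have -> : P * (4 * d * (c * t ^ 2)) = 4 * d * P * (c * t * t) by ring.
    have -> : 32 * d * P * S * N = 4 * d * P * (8 * S * N) by ring.
    by rewrite leq_mul2l leq_mul ?orbT.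
  move: lsb; rewrite mem_filter => /andP[/negP bad _]; case: bad; rewrite /good.
  have hc2 : c ^ 8 <= 256 * size sb ^ 8.
    by rewrite -[256]/(2 ^ 8) -expnMn leq_exp2r //; lia.
  apply: (@leq_trans (256 * (N ^ 4 * size sb ^ 8 * t ^ 18))).
    have -> : 256 * (N ^ 4 * size sb ^ 8 * t ^ 18) = N ^ 4 * (256 * size sb ^
      8) * t ^ 18 by ring.
    by rewrite leq_mul2r leq_mul2l hc2 !orbT.
  apply: leq_trans (leq_mul (leqnn _) hl) _.
  by apply: eq_leq; rewrite -/S -/E; ring.
right.
have sg0 : 0 < size sg by lia.
have [l0 l0s hT] := ex_min_seq (fun l => size (prods A (fib A l))) sg0.
move: hT; set T := size (prods A (fib A l0)) => hT.
(* Averaging over a in A: the fibres A_l of the good slopes have total size at least c t / 2, so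
   some a lies in at least c t / (2N) of them. For this a, D a is contained in A, hence D + D in (A
   + A) / a. *)
have [a aA ha] := ex_large_term (fun a => \sum_(l <- sg) ((l * a)%R \in A)) N0.
pose D := [seq l <- sg | (l * a)%R \in A].
have a0 : (0 < a)%R by apply: A0.
have sizeD : \sum_(l <- sg) ((l * a)%R \in A) = size D.
  by rewrite size_filter -sum1_count [RHS]big_mkcond; apply: eq_bigr => l _;
    case: ifP.
have hD : c * t <= 2 * N * size D.
  apply: (@leq_trans (2 * (size sg * t)));
    first by rewrite mulnA leq_mul2r hsg orbT.
  rewrite -mulnA leq_mul2l /=; rewrite sizeD in ha; apply: leq_trans ha.
  rewrite exchange_big -sum_const_seq /=; apply: leq_sum_seq => l.
  by rewrite mem_filter => /andP[_ /hs0/andP[]].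
have uD : uniq D by do 2!apply: filter_uniq.
pose SD := [seq (x / a)%R | x <- sums A].
have uSD : uniq SD.
  by rewrite map_inj_uniq ?undup_uniq //; apply: mulIf; rewrite invr_eq0 gt_eqF.
have hSD : {in D &, forall x y, (x + y)%R \in SD}.
  move=> x y; rewrite !mem_filter => /andP[xa _] /andP[ya _].
  apply/mapP; exists (x * a + y * a)%R; first exact: mem_sums.
  by rewrite -mulrDl mulfK // gt_eqF.
have sizeSD : size SD = S by rewrite size_map.
have DA : size D <= N.
  rewrite -(size_map (fun l => l * a)%R); apply: uniq_leq_size.
    by rewrite map_inj_uniq //; apply: mulIf; rewrite gt_eqF.
  by move=> z /mapP[l]; rewrite mem_filter => /andP[h _] ->.
have Dd : size D < 2 ^ d := leq_ltn_trans DA Ad.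
have NS : N <= S := size_sums uA.
have hTD : {in D, forall l, T <= size (prods A (fib A l))}.
  by move=> l; rewrite mem_filter => /andP[_]; apply: hT.
have [p [rho [h1 h2 h3]]] := schoen_shkredov uD uSD hSD d0 Dd.
exists c, t, T, (size D), p, rho, (\sum_(z <- differences D SD) diff_rep D SD z
  ^ 2),
  (\sum_(z <- differences D D) diff_rep D D z ^ 3),
  (\sum_(z <- differences D SD) diff_rep D SD z ^ 3).
rewrite sizeSD in h2; split; split=> //.
- by apply: leq_trans (prods_fib_quot_rep _ _) (quot_rep_le _ _).
- by move: l0s; rewrite mem_filter => /andP[].
- by apply: leq_trans (sum_square_cauchy _ _) _; rewrite sum_diff_rep // sizeSD.
- exact: third_moment.
- rewrite -sizeSD; apply: third_moment => //.
  by rewrite sizeSD (leq_trans DA).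
Qed.

(** * Conclusion *)

Local Open Scope ring_scope.

Definition lnat (R : realType) (n : nat) : R := ln n%:R.
Arguments lnat : clear implicits.

Lemma lnatM (R : realType) (m n : nat) :
  (0 < m)%N -> (0 < n)%N -> lnat R (m * n) = lnat R m + lnat R n.
Proof. by move=> m0 n0; rewrite /lnat natrM lnM // posrE ltr0n. Qed.

Lemma lnatX (R : realType) (m k : nat) :
  (0 < m)%N -> lnat R (m ^ k) = k%:R * lnat R m.
Proof. by move=> m0; rewrite /lnat natrX lnXn ?ltr0n // mulr_natl. Qed.

Lemma lnat_le (R : realType) (m n : nat) :
  (0 < m)%N -> (m <= n)%N -> lnat R m <= lnat R n.
Proof.
by move=> m0 mn; rewrite /lnat ler_ln ?posrE ?ltr0n ?ler_nat // (leq_trans m0).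
Qed.

Lemma lnat_ge0 (R : realType) (m : nat) : (0 < m)%N -> 0 <= lnat R m.
Proof. by move=> m0; rewrite /lnat ln_ge0 // ler1n. Qed.

(** In logarithms the estimates become linear inequalities, and [m] bounds both set sizes. The
    factor 1000 generously covers the multipliers of the constants and of log d. *)
Lemma sum_product_positive (R : realType) :
  exists2 C : R, 0 <= C & forall (A : seq R) (d m : nat), uniq A ->
    {in A, forall x, 0 < x} -> (0 < size A)%N -> (0 < d)%N ->
    (size A < 2 ^ d)%N -> (size (sums A) <= m)%N -> (size (prods A A) <= m)%N ->
    722 * lnat R (size A) <= C + 1000 * lnat R d + 541 * lnat R m.
Proof.
(* The constant is kept as an arbitrary upper bound [K], so that the large numeral is never
   expanded. *)
have ex_ge n : exists K, (n <= K)%N by exists n; apply: leqnn.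
have [K hK] := ex_ge (256 ^ 4 * (64 * 129))%N.
have K0 : (0 < K)%N by apply: leq_trans hK; rewrite muln_gt0 expn_gt0.
exists (1000 * (lnat R 2 + lnat R 4 + lnat R 256 + lnat R K + lnat R 257 + lnat
  R 32)).
  by rewrite mulr_ge0 // !addr_ge0 // lnat_ge0.
move=> A d m uA A0 N0 d0 Ad hS hP.
have P0 : (0 < size (prods A A))%N := leq_trans N0 (size_prods uA A0).
have S0 : (0 < size (sums A))%N := leq_trans N0 (size_sums uA).
have lP := lnat_le R P0 hP; have lS := lnat_le R S0 hS.
have lP0 := lnat_ge0 R P0; have lS0 := lnat_ge0 R S0.
have ld0 := lnat_ge0 R d0; have lN0 := lnat_ge0 R N0.
have l2 : 0 <= lnat R 2 by apply: lnat_ge0.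
have l4 : 0 <= lnat R 4 by apply: lnat_ge0.
have lK := lnat_ge0 R K0.
have l256 : 0 <= lnat R 256 by apply: lnat_ge0.
have l257 : 0 <= lnat R 257 by apply: lnat_ge0.
have l32 : 0 <= lnat R 32 by apply: lnat_ge0.
have := sum_product_estimates hK uA A0 N0 d0 Ad.
clear hK.
move: lP lS lP0 lS0 lN0 P0 S0 N0.
move: (size (prods A A)) (size (sums A)) (size A) (mul_energy A) => P S N E.
move=> lP lS lP0 lS0 lN0 P0 S0 N0 [h|].
  have N3 : (0 < N ^ 3)%N by rewrite expn_gt0 N0.
  have := lnat_le R N3 h.
  rewrite !(lnatX, lnatM) ?muln_gt0 ?d0 ?P0 //; lra.
move=> [c [t [T [n [p [rho [F2 [E3 [F3 [[a1 a2 a3 a4 a5] [b1 b2 b3 b4] [c1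
  c2]]]]]]]]]]].
have E_gt0 : (0 < E)%N.
  have : (0 < N ^ 4)%N by rewrite expn_gt0 N0.
  by move=> /leq_trans/(_ a1); rewrite muln_gt0 => /andP[].
have [c_gt0 t_gt0] : (0 < c)%N /\ (0 < t)%N.
  by move: (leq_trans E_gt0 a2); rewrite !muln_gt0 => /andP[_ /and3P[]].
have T_gt0 : (0 < T)%N.
  have : (0 < N ^ 4 * c ^ 8 * t ^ 18)%N by rewrite !(expn_gt0, muln_gt0) N0
    c_gt0 t_gt0.
  by move=> /leq_trans/(_ a4);
    rewrite muln_gt0 [(0 < T ^ 2)%N]expn_gt0 orbF => /andP[].
have n_gt0 : (0 < n)%N.
  have : (0 < c * t)%N by rewrite muln_gt0 c_gt0.
  by move=> /leq_trans/(_ a5); rewrite muln_gt0 => /andP[].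
have [p_gt0 rho_gt0] : (0 < p)%N /\ (0 < rho)%N.
  have : (0 < n ^ 4)%N by rewrite expn_gt0 n_gt0.
  move=> /leq_trans/(_ b3).
  by rewrite !muln_gt0 => /andP[_ /andP[_ /and3P[]]].
have E3_gt0 : (0 < E3)%N.
  by apply: leq_trans b4; rewrite muln_gt0 p_gt0 expn_gt0 rho_gt0.
have F2_gt0 : (0 < F2)%N.
  have : (0 < (p * rho * n) ^ 2 * rho)%N.
    by rewrite !(expn_gt0, muln_gt0) p_gt0 rho_gt0 n_gt0.
  by move=> /leq_trans/(_ b1); rewrite muln_gt0 => /andP[].
have F3_gt0 : (0 < F3)%N.
  have : (0 < F2 ^ 2)%N by rewrite expn_gt0 F2_gt0.
  by move=> /leq_trans/(_ b2); rewrite muln_gt0 => /andP[].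
pose pos := (expn_gt0, muln_gt0, N0, P0, S0, d0, K0, E_gt0, c_gt0, t_gt0, T_gt0,
  n_gt0, p_gt0, rho_gt0, E3_gt0, F2_gt0, F3_gt0).
have {}a1 : lnat R (N ^ 4) <= lnat R (P * E).
  by apply: lnat_le a1; rewrite !pos.
have {}a2 : lnat R (E) <= lnat R (4 * d * (c * t ^ 2)).
  by apply: lnat_le a2; rewrite !pos.
have {}a3 : lnat R (T) <= lnat R (P).
  by apply: lnat_le a3; rewrite !pos.
have {}a4 : lnat R (N ^ 4 * c ^ 8 * t ^ 18) <= lnat R (256 * K * d * S ^ 16 * E
  * T ^ 2).
  by apply: lnat_le a4; rewrite !pos.
have {}a5 : lnat R (c * t) <= lnat R (2 * N * n).
  by apply: lnat_le a5; rewrite !pos.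
have {}b1 : lnat R ((p * rho * n) ^ 2 * rho) <= lnat R (F2 * E3).
  by apply: lnat_le b1; rewrite !pos.
have {}b2 : lnat R (F2 ^ 2) <= lnat R (n * S * F3).
  by apply: lnat_le b2; rewrite !pos.
have {}b3 : lnat R (n ^ 4) <= lnat R (S * (4 * d * (p * rho ^ 2))).
  by apply: lnat_le b3; rewrite !pos.
have {}b4 : lnat R (p * rho ^ 3) <= lnat R (E3).
  by apply: lnat_le b4; rewrite !pos.
have {}c1 : lnat R (T ^ 3 * E3) <= lnat R (257 * d * P ^ 4 * n ^ 2).
  by apply: lnat_le c1; rewrite !pos.
have {}c2 : lnat R (T ^ 3 * F3) <= lnat R (257 * d * P ^ 4 * S ^ 2).
  by apply: lnat_le c2; rewrite !pos.
(* Up to constants and powers of d, the b's and c's combine to n^19 T^15 <= S^9 P^20. Squaring this,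
   multiplying by T^8 <= P^8 and inserting [a5] to the power 38 and [a4] to the power 19 makes c and
   t occur as (c t^2)^190; then [a2] and [a1] give N^722 <= S^322 P^219, and 322 + 219 = 541. *)
move: a1 a2 a3 a4 a5 b1 b2 b3 b4 c1 c2.
rewrite !(lnatX, lnatM) ?pos //.
lra.
Qed.

(** The larger of the positive and the negative part is kept. A change of sign preserves products of
    two elements and only reflects the sums. *)
Lemma positive_half (R : realType) (A : {fset R}) : 0 \notin A ->
  exists B : seq R, [/\ uniq B, {in B, forall x, 0 < x},
    (size B <= #|` A| <= 2 * size B)%N, (size (sums B) <= #|` sumset A A|)%N &
    (size (prods B B) <= #|` prodset A A|)%N].
Proof.
move=> A0.
pose Bp := [seq x <- A | 0 < x]; pose Bn := [seq - x | x <- A & x < 0].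
have uA : uniq A := fset_uniq A.
have hsize : (size Bp + size Bn = #|` A|)%N.
  rewrite size_map !size_filter -(count_predC (fun x : R => 0 < x) A);
    congr (_ + _)%N.
  apply: eq_in_count => x xA /=; rewrite -leNgt le_eqVlt.
  by case: eqP => // x0; move: A0; rewrite -x0 xA.
case: (leqP (size Bn) (size Bp)) => h.
  exists Bp; split; first exact: filter_uniq.
  - by move=> x; rewrite mem_filter => /andP[].
  - by rewrite -hsize leq_addr mul2n -addnn leq_add2l.
  - apply: uniq_leq_size; first exact: undup_uniq.
    move=> z; rewrite mem_undup => /allpairsP[[x y] /= []].
    rewrite !mem_filter => /andP[_ xA] /andP[_ yA] ->.
    by apply/imfset2P; exists x => //; exists y.
  - apply: uniq_leq_size; first exact: undup_uniq.
    move=> z /prodsP[x [y []]].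
    rewrite !mem_filter => /andP[_ xA] /andP[_ yA] ->.
    by apply/imfset2P; exists x => //; exists y.
exists Bn; split.
- by rewrite map_inj_uniq ?filter_uniq //; apply: oppr_inj.
- by move=> z /mapP[x]; rewrite mem_filter => /andP[x0 _] ->; rewrite oppr_gt0.
- by rewrite -hsize leq_addl mul2n -addnn leq_add2r ltnW.
- rewrite -(size_map -%R); apply: uniq_leq_size.
    by rewrite map_inj_uniq ?undup_uniq //; apply: oppr_inj.
  move=> z /mapP[s]; rewrite mem_undup => /allpairsP[[x y] /= [/mapP[x' hx ->]
    /mapP[y' hy ->] ->]] ->.
  move: hx hy; rewrite !mem_filter => /andP[_ xA] /andP[_ yA].
  by apply/imfset2P; exists x' => //; exists y' => //; rewrite opprD !opprK.
- apply: uniq_leq_size; first exact: undup_uniq.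
  move=> z /prodsP[x [y [/mapP[x' hx ->] /mapP[y' hy ->] ->]]].
  move: hx hy; rewrite !mem_filter => /andP[_ xA] /andP[_ yA].
  by apply/imfset2P; exists x' => //; exists y' => //; rewrite mulrNN.
Qed.

Theorem corollary13 (R : realType) :
  exists C0 : R, 0 < C0 /\
    forall A : {fset R}, 0 \notin A -> (1 < #|` A|)%N ->
      gtrsim_with C0 #|` A|
        (maxn #|` sumset A A| #|` prodset A A|)%:R
        (#|` A|%:R `^ (4 / 3 + 1 / 1509)).
Proof.
have [C C_ge0 hC] := sum_product_positive R.
have ln2_gt0 : 0 < lnat R 2 by rewrite /lnat ln_gt0 // ltr1n.
(* With C0 = expR c, the factor C0 contributes c to the logarithm of the bound, which covers the
   constants, while the exponent C0 >= 1 + c exceeds the 10 needed for the loglog term. *)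
pose c := C + 5000 + 6000 * lnat R 2.
exists (expR c); split; first exact: expR_gt0.
move=> A A0 A1; set N := #|` A| in A1 *; set m := maxn _ _.
have [B [uB B0 /andP[hB1 hB2] hS hP]] := positive_half A0.
pose d := (trunc_log 2 N).+1.
have N0 : (0 < N)%N := ltnW A1.
have /andP[hd1 hd2] := trunc_log_bounds (isT : (1 < 2)%N) N0.
have tl0 : (0 < trunc_log 2 N)%N.
  by rewrite -ltnS -(ltn_exp2l _ _ (isT : (1 < 2)%N)) (leq_ltn_trans _ hd2).
have B_gt0 : (0 < size B)%N by have := leq_trans N0 hB2;
  rewrite muln_gt0 => /andP[].
have Bd : (size B < 2 ^ d)%N := leq_ltn_trans hB1 hd2.
have Bm1 : (size (sums B) <= m)%N := leq_trans hS (leq_maxl _ _).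
have Bm2 : (size (prods B B) <= m)%N := leq_trans hP (leq_maxr _ _).
have m0 : (0 < m)%N := leq_trans B_gt0 (leq_trans (size_sums uB) Bm1).
have h := hC B d m uB B0 B_gt0 (ltn0Sn _) Bd Bm1 Bm2.
have lN : lnat R N <= lnat R 2 + lnat R (size B).
  by rewrite -lnatM //; apply: lnat_le.
have hlog : (trunc_log 2 N)%:R <= log2 N%:R :> R.
  by rewrite /log2 ler_pdivlMr // -[ln 2]/(lnat R 2) -lnatX // lnat_le //
    expn_gt0.
have ld : lnat R d <= lnat R 2 + ln (log2 N%:R).
  (* As N >= 2, the truncated logarithm is at least 1, so d is at most twice it. *)
  apply: le_trans (_ : lnat R (2 * trunc_log 2 N) <= _).
    by apply: lnat_le; rewrite // /d mul2n -addnn -addn1 leq_add2l.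
  rewrite lnatM // lerD2l /lnat ler_ln // posrE ?ltr0n //.
  by apply: lt_le_trans hlog; rewrite ltr0n.
have log1 : 1 <= log2 N%:R :> R by apply: le_trans hlog; rewrite ler1n.
have llog0 := ln_ge0 log1.
have lN0 := lnat_ge0 R N0.
have expc := expR_ge1Dx c.
rewrite /gtrsim_with.
have -> : N%:R `^ (4 / 3 + 1 / 1509) = expR ((4 / 3 + 1 / 1509) * lnat R N).
  by rewrite /powR gt_eqF // ltr0n.
have -> : log2 N%:R `^ expR c = expR (expR c * ln (log2 N%:R)).
  by rewrite /powR gt_eqF // (lt_le_trans ltr01).
have -> : m%:R = expR (lnat R m) by rewrite /lnat lnK // posrE ltr0n.
rewrite -!expRD ler_expR.
have : 10 * ln (log2 N%:R) <= expR c * ln (log2 N%:R).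
  apply: ler_wpM2r => //; rewrite /c in expc *; lra.
move=> h10; rewrite {1}/c; move: (expR c * _) h10 => y h10; lra.
Qed.
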